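(* Let $T>0$ and let $a,b,c\colon[0,T]\to\mathbb R$ be measurable functions satisfying (C1)–(C3) below, with $h$ the function from (C3). For a given function $u$ on $[0,T]$, consider the equation (with unknown $f$) $$\mathcal Kf(t)=\int_0^ta(s)\int_s^tb(v)c(v-s)\,dv\,f(s)\,ds=\int_0^tu(z)\,dz,\qquad t\in[0,T].$$ Then its solution has the form $$f(t)=a^{-1}(t)\,D_{0+}^h(ub^{-1})(t),$$ under the assumption that the right-hand side of this formula is well defined and $D_{0+}^h(ub^{-1})\in L_1([0,T])$.
   Context: (C1) $a\in L_{p}([0,T])$, $b\in L_{q}([0,T])$, $c\in L_{r}([0,T])$ for $p\in[2,\infty]$, $q\in[1,\infty]$, $r\in[1,\infty]$ such that $\frac1p+\frac1q+\frac1r\le\frac32$. (C2) $a,b$ are positive a.e. on $[0,T]$. (C3) $c$ creates a Sonine pair with some $h\in L_1([0,T])$, i.e. $\int_0^tc(t-s)h(s)\,ds=1$ for any $t\in[0,T]$. The operator $D_{0+}^h$ (analogue of the fractional derivative) is defined by $(D_{0+}^hg)(t)=\frac{d}{dt}\left(\int_0^th(t-s)g(s)\,ds\right)$ for functions $g\colon[0,T]\to\mathbb R$ such that $t\mapsto\int_0^th(t-s)g(s)\,ds$ is absolutely continuous on $[0,T]$. Here $a^{-1}=1/a$ and $b^{-1}=1/b$. *)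

(* Defs.v *)
From HB Require Import structures.
From mathcomp Require Import all_boot all_order all_algebra.
From mathcomp Require Import all_classical all_reals all_analysis.
Set Implicit Arguments.
Unset Strict Implicit.
Unset Printing Implicit Defensive.
Import Order.TTheory GRing.Theory Num.Theory.
Import numFieldNormedType.Exports.
Local Open Scope classical_set_scope.
Local Open Scope ring_scope.

(* Functions on [0, T] are total functions R -> R, and every definition below
   only inspects their values on [0, T]; the one exception is the two-sided
   derivative at the single point T in [Dfrac]. Everywhere [Rintegral] is a
   total operator (0 or junk without absolute convergence), hence the explicit
   integrability clauses. *)

(* f \in L_p([0, T]), 1 <= p <= +oo: the extension of f by zero is in L_p(R);
   this includes the measurability of f on [0, T]. *)
Definition Lp_on (R : realType) (T : R) (p : \bar R) (f : R -> R) : Prop :=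
  (f \_ `[0, T]) \in Lfun (@lebesgue_measure R) p.

(* Degenerate intervals (x i = y i) are allowed and contribute nothing. *)
Definition abs_cont_on (R : realType) (A B : R) (F : R -> R) : Prop :=
  forall e : R, 0 < e -> exists2 d : R, 0 < d &
    forall (n : nat) (x y : 'I_n -> R),
      (forall i, [/\ A <= x i, x i <= y i & y i <= B]) ->
      trivIset [set: 'I_n] (fun i => [set` `]x i, y i[]) ->
      \sum_(i < n) (y i - x i) < d ->
      \sum_(i < n) `|F (y i) - F (x i)| < e.

(* The integral of k (t - s) g s over s in [0, t] converges absolutely. *)
Definition volterra_conv_defined (R : realType) (k g : R -> R) (t : R) : Prop :=
  (@lebesgue_measure R).-integrable `[0, t] (fun s => (k (t - s) * g s)%:E).

Definition volterra_conv (R : realType) (k g : R -> R) (t : R) : R :=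
  \int[@lebesgue_measure R]_(s in `[0, t]) (k (t - s) * g s).

(* The integral vanishes at t = 0, so the identity is required on ]0, T]. *)
Definition sonine_pair (R : realType) (T : R) (c h : R -> R) : Prop :=
  Lp_on T 1 h /\
  forall t : R, 0 < t <= T -> volterra_conv_defined c h t /\ volterra_conv c h t = 1.

Definition Dfrac_defined (R : realType) (T : R) (h g : R -> R) : Prop :=
  (forall t : R, 0 <= t <= T -> volterra_conv_defined h g t) /\
  abs_cont_on 0 T (volterra_conv h g).

(* Meaningful for almost every t in [0, T] when [Dfrac_defined T h g] holds. *)
Definition Dfrac (R : realType) (h g : R -> R) : R -> R := derive1 (volterra_conv h g).

Definition Kop (R : realType) (a b c f : R -> R) (t : R) : R :=
  \int[@lebesgue_measure R]_(s in `[0, t])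
    (a s * (\int[@lebesgue_measure R]_(v in `[s, t]) (b v * c (v - s))) * f s).

(* The unknowns for which [Kop a b c f] makes sense on [0, T]: f is
   square-integrable (the natural domain under
   1/p + 1/q + 1/r <= 3/2), or, more generally, the double integral over
   0 <= s <= v <= T converges absolutely. *)
Definition Kop_admissible (R : realType) (T : R) (a b c f : R -> R) : Prop :=
  measurable_fun `[0, T] f /\
  (Lp_on T 2%:E f \/
   (@lebesgue_measure R \x @lebesgue_measure R)%E.-integrable
     [set z : R * R | [/\ 0 <= z.1, z.1 <= z.2 & z.2 <= T]]
     (fun z => (a z.1 * b z.2 * c (z.2 - z.1) * f z.1)%:E)).

(* Main.v *)
Require Import Defs.
From HB Require Import structures.
From mathcomp Require Import all_boot all_order all_algebra.
From mathcomp Require Import all_classical all_reals all_analysis.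
From mathcomp Require Import measurable_realfun ess_sup_inf.
From mathcomp Require Import ring lra.
Import Order.TTheory GRing.Theory Num.Theory.
Import numFieldNormedType.Exports.
Local Open Scope classical_set_scope.
Local Open Scope ring_scope.

Set Implicit Arguments.
Unset Strict Implicit.
Unset Printing Implicit Defensive.

(** Put phi = a f and g = u / b, and write * for convolution on the half-line. Exchanging the order
    of integration turns K f (t) into the integral over [0, t] of b times c * phi ([Kop_integral],
    [volterra_density_conv]). Two primitives agree on [0, T] iff their integrands agree a.e., and b
    > 0 a.e., so the equation says exactly that c * phi = g a.e. Convolving with h and using h * c =
    1 gives h * g = 1 * phi, the primitive of phi. Conversely, if h * g = 1 * phi, then y = c * phi
    also satisfies h * y = 1 * phi, so h * (g - y) = 0; convolving with c shows that the primitive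
    of g - y vanishes, hence g = y a.e. This is [sonine_equivalence]. Finally, h * g is absolutely
    continuous and vanishes at 0, so it is the primitive of phi iff its derivative is phi a.e., that
    is, iff f is D g divided by a.

    Three points of analysis carry this sketch.

    Fubini needs an absolutely convergent double integral. For square-integrable f this is a
    Young-type inequality ([young_kernel_finite]): the integrand is dominated by a sum of products
    of two integrable functions of two of the variables s, v, v - s.

    Neither phi nor g is assumed integrable. Convergence of the convolutions containing them forces
    integrability on [0, S] for every S < T ([conv_local_integrability]), because c and h cannot
    vanish a.e. near 0. The inversion is therefore carried out on each [0, S], and S tends to T
    ([ae_itv_exhaust]).

    An absolutely continuous function is the integral of its derivative. [abs_cont_density] obtains
    a density from the Jordan decomposition, Stieltjes measures and Radon-Nikodym;
    [ae_derive_integral] identifies it with the derivative. *)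

Definition clamp (R : realType) (T x : R) : R := Num.max 0 (Num.min x T).

(** * Extending functions from [0, T] to the line *)

Section clamp.
Context {R : realType}.
Implicit Types (T x y : R).

Lemma clamp_itv T x : 0 <= T -> 0 <= clamp T x <= T.
Proof. by move=> T0; rewrite /clamp le_max lexx/= ge_max T0 ge_min lexx orbT. Qed.

Lemma clamp_id T x : 0 <= x <= T -> clamp T x = x.
Proof. by move=> /andP[x0 xT]; rewrite /clamp min_l// max_r. Qed.

Lemma clamp_nd T : {homo clamp T : x y / x <= y}.
Proof.
move=> x y xy; rewrite /clamp ge_max !le_max lexx/=; apply/orP; right.
by rewrite le_min !ge_min xy lexx orbT.
Qed.

Lemma clamp_dist T x y : 0 <= T -> `|clamp T x - clamp T y| <= `|x - y|.
Proof.
move=> T0; wlog xy : x y / x <= y => [H|].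
  by have [/H//|/ltW/H] := leP x y; rewrite distrC (distrC y).
rewrite ler0_norm ?subr_le0 ?clamp_nd// ler0_norm ?subr_le0// !opprB.
rewrite /clamp /Num.max /Num.min; case: (ltP x T) => xT; case: (ltP y T) => yT;
  (try case: (ltP 0 x) => x0); (try case: (ltP 0 y) => y0);
  (try case: (ltP 0 T) => T00); lra.
Qed.

(** The projection onto [0, T] is 1-Lipschitz, so relative continuity on [0, T] becomes continuity
    on the whole line. *)
Lemma clamp_continuous T (f : R -> R) : 0 < T ->
  {within `[0, T], continuous f} -> continuous (f \o clamp T).
Proof.
move=> T0 fc x; apply/(@cvgrPdist_lt _ R^o) => e e0.
have /= := clamp_itv x (ltW T0).
set y := clamp T x => yT.
have yin : `[0, T]%classic y by rewrite /= in_itv.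
have : f @ within `[0, T]%classic (nbhs y) --> f y.
  by rewrite (nbhs_subspace_in yin); exact: fc.
move=> /(@cvgrPdist_lt _ R^o)/(_ e e0)[d /= d0 dP].
exists d => //= z /= xz; apply: dP => /=.
  by exact: le_lt_trans (clamp_dist _ _ (ltW T0)) xz.
by rewrite in_itv/= clamp_itv// ltW.
Qed.

End clamp.

(** * Absolute continuity implies continuity and bounded variation *)

Section abs_cont.
Context {R : realType}.
Variables (T : R) (H : R -> R).
Hypotheses (T0 : 0 < T) (acH : abs_cont_on 0 T H).

Lemma abs_cont_clamp_continuous : continuous (H \o clamp T).
Proof.
move=> x; apply/(@cvgrPdist_lt _ R^o) => e e0.
have [d d0 dP] := acH e0.
exists d => //= z /= xz.
have h a b : a <= b -> `|a - b| < d -> `|H (clamp T a) - H (clamp T b)| < e.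
  move=> ab abd.
  have := dP 1%N (fun=> clamp T a) (fun=> clamp T b).
  rewrite !big_ord1 distrC; apply.
  - move=> _; split; [|exact: clamp_nd|].
      by have /andP[] := clamp_itv a (ltW T0).
    by have /andP[] := clamp_itv b (ltW T0).
  - by move=> i j; rewrite (ord1 i) (ord1 j).
  - rewrite (le_lt_trans _ abd)// (le_trans _ (clamp_dist a b (ltW T0)))// distrC.
    exact: ler_norm.
have [xlez|/ltW zx] := leP x z; first exact: h.
by rewrite distrC; apply: h => //; rewrite distrC.
Qed.

Lemma abs_cont_within_continuous : {within `[0, T], continuous H}.
Proof.
apply: (@subspace_eq_continuous _ _ _ (H \o clamp T)).
  by move=> x; rewrite inE/= in_itv/= => xT; rewrite clamp_id.
by apply: continuous_subspaceT; exact: abs_cont_clamp_continuous.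
Qed.

(** The cells of any partition of an interval shorter than d are disjoint with total length below d,
    so every variation sum is below 1. *)
Lemma abs_cont_short_BV (d : R) (x y : R) : 0 <= x -> x <= y -> y <= T ->
  (forall (n : nat) (x y : 'I_n -> R),
      (forall i, [/\ 0 <= x i, x i <= y i & y i <= T]) ->
      trivIset [set: 'I_n] (fun i => [set` `]x i, y i[]) ->
      \sum_(i < n) (y i - x i) < d ->
      \sum_(i < n) `|H (y i) - H (x i)| < 1) ->
  y - x < d -> bounded_variation x y H.
Proof.
move=> x0 xy yT dP yxd; exists 1 => _ [s sP <-].
rewrite /variation big_mkord ltW//.
have sorted_s : forall i j : nat, (i <= j)%N -> (j <= size s)%N ->
    nth y (x :: s) i <= nth y (x :: s) j.
  move=> i j ij js; case: sP => /= ps _.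
  apply: (@sorted_leq_nth _ <=%R le_trans lexx y (x :: s)) => //.
  - by apply: sub_path ps => a b; exact: ltW.
  - by rewrite inE/= ltnS (leq_trans ij).
apply: (dP _ (fun i => nth y (x :: s) i) (fun i => nth y (x :: s) i.+1)) => [i||].
- split; last 2 first.
  + exact: sorted_s (leqnSn _) (ltn_ord i).
  + have h := @itv_partition_nth_le _ _ x y s i.+1.
    by apply: le_trans yT; apply: h => //; rewrite ltnS.
  + have h := @itv_partition_nth_ge _ _ x y s i.
    by apply: (le_trans x0); apply: h => //; rewrite ltnS ltnW.
- move=> i j _ _ [z []] /=; rewrite !in_itv/= => /andP[iz zi] /andP[jz zj].
  apply/val_inj/eqP; rewrite eqn_leq; apply/andP; split; rewrite leqNgt; apply/negP => ij.
    have := sorted_s j.+1 i ij (ltnW (ltn_ord i)); rewrite leNgt => /negP; apply.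
    exact: lt_trans iz zj.
  have := sorted_s i.+1 j ij (ltnW (ltn_ord j)); rewrite leNgt => /negP; apply.
  exact: lt_trans jz zi.
- rewrite -(big_mkord xpredT (fun i => nth y (x :: s) i.+1 - nth y (x :: s) i)).
  by rewrite telescope_sumr//= (itv_partition_nth_size y sP).
Qed.

(** Cut [0, T] into n + 1 equal pieces shorter than the d belonging to e = 1; the total variation is
    additive and finite on each piece. *)
Lemma abs_cont_BV : bounded_variation 0 T H.
Proof.
have [d d0 dP] := acH ltr01.
have [n Tn] : exists n : nat, T / n.+1%:R < d.
  exists (Num.bound (T / d)); rewrite ltr_pdivrMr// mulrC -ltr_pdivrMr//.
  by rewrite (lt_le_trans (archi_boundP _))// ?ler_nat// divr_ge0// ltW.
suff h k : (k <= n.+1)%N -> total_variation 0 (k%:R * (T / n.+1%:R)) H \is a fin_num.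
  apply/bounded_variationP; first exact: ltW.
  by have := h _ (leqnn _); rewrite mulrC divfK.
have q0 : 0 <= T / n.+1%:R by rewrite divr_ge0// ltW.
elim: k => [|k ih kn]; first by rewrite mul0r total_variationxx.
rewrite (@total_variationD _ _ _ (k%:R * (T / n.+1%:R)))//; last 2 first.
- by rewrite mulr_ge0.
- by rewrite ler_wpM2r// ler_nat.
rewrite fin_numD ih ?(ltnW kn)//=.
apply/bounded_variationP; first by rewrite ler_wpM2r// ler_nat.
apply: (@abs_cont_short_BV d) => //.
- by rewrite mulr_ge0.
- by rewrite ler_wpM2r// ler_nat.
- by rewrite mulrCA ger_pMr// ler_pdivrMr// mul1r ler_nat.
- by rewrite -mulrBl -natrB// subSnn mul1r.
Qed.

End abs_cont.

(** * Stieltjes measure of finite unions of half-open intervals *)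

Section ocitv_ring.
Context {R : realType}.

(** This form matches the finite disjoint families of intervals that absolute continuity quantifies
    over. *)
Lemma ocitv_ring_decomp (B : set (ocitv_type R)) :
  (ocitv_display R).-ring.-measurable B ->
  exists n (x y : 'I_n -> R), [/\ forall i, x i < y i,
    trivIset [set: 'I_n] (fun i => `]x i, y i]%classic) &
    B = \bigcup_i `]x i, y i]%classic].
Proof.
move=> /(@SetRing.ring_finite_set _ (ocitv_type R))[S [finS S0 tS mS ->]].
have [s [us sS]] : exists s : seq (set R), uniq s /\ S = [set` s].
  have [s ->] := (finite_seqP _).1 finS.
  by exists (undup s); split; [exact: undup_uniq|apply/seteqP; split => z /=; rewrite mem_undup].
have ex (i : 'I_(size s)) : exists z : R * R, z.1 < z.2 /\ nth set0 s i = `]z.1, z.2]%classic.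
  have Si : S (nth set0 s i) by rewrite sS/=; exact: mem_nth.
  have /ocitvP := mS _ (mem_set Si).
  case=> [e|[z z12 e]]; last by exists z.
  by have [w] := S0 _ Si; rewrite e.
have [z zP] := choice ex.
exists (size s), (fun i => (z i).1), (fun i => (z i).2); split=> [i||].
- by have [] := zP i.
- move=> i j _ _ [w [wi wj]].
  have Si (k : 'I_(size s)) : S (nth set0 s k) by rewrite sS/=; exact: mem_nth.
  have := tS _ _ (Si i) (Si j); rewrite (zP i).2 (zP j).2.
  move=> /(_ (ex_intro _ w (conj wi wj))).
  rewrite -(zP i).2 -(zP j).2 => /eqP; rewrite nth_uniq// => /eqP; exact: val_inj.
- apply/seteqP; split => [w [X SX Xw]|w [i _ /= wi]].
    move: SX; rewrite sS/= => /(nthP set0)[i ilt iX].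
    by exists (Ordinal ilt) => //; rewrite -(zP _).2/= iX.
  exists (nth set0 s i); last by rewrite (zP i).2.
  by rewrite sS/=; exact: mem_nth.
Qed.

Lemma lebesgue_stieltjes_itv_oc (f : cumulative R R) (x y : R) : x <= y ->
  lebesgue_stieltjes_measure f `]x, y]%classic = (f y - f x)%:E.
Proof.
move=> xy; rewrite /lebesgue_stieltjes_measure/= /measure_extension/=.
by rewrite measurable_mu_extE/=; [rewrite wlength_itv_bnd|exact: is_ocitv].
Qed.

Lemma lebesgue_stieltjes_disjoint_ocitv (f : cumulative R R) n (x y : 'I_n -> R) :
  (forall i, x i < y i) -> trivIset [set: 'I_n] (fun i => `]x i, y i]%classic) ->
  lebesgue_stieltjes_measure f (\bigcup_i `]x i, y i]%classic) =
  (\sum_(i < n) (f (y i) - f (x i)))%:E.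
Proof.
move=> xy tA; have mA i : measurable (`]x i, y i]%classic : set (measurableTypeR R)).
  by apply: sub_sigma_algebra; exact: is_ocitv.
have sT : [set: 'I_n] = [set` enum 'I_n].
  by apply/seteqP; split => // i _ /=; rewrite mem_enum.
rewrite measure_fin_bigcup//=.
rewrite sT -fsbig_seq ?enum_uniq// big_enum/= -sumEFin.
by apply: eq_bigr => i _; rewrite lebesgue_stieltjes_itv_oc// ltW.
Qed.

End ocitv_ring.

(** * Density of an absolutely continuous difference of monotone functions *)

Section charge_of_difference.
Context {R : realType}.
Variables (V W : cumulative R R) (T : R).
Hypothesis T0 : 0 < T.
Hypothesis acF : abs_cont_on 0 T (fun t => V t - W t).

Notation mu := (@lebesgue_measure R).
Notation LS := lebesgue_stieltjes_measure.
Let D : set (measurableTypeR R) := `]0, T]%classic.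

Let mD : measurable D.
Proof. by apply: sub_sigma_algebra; exact: is_ocitv. Qed.

Let LSD_fin (f : cumulative R R) : (LS f D < +oo)%E.
Proof. by rewrite lebesgue_stieltjes_itv_oc ?ltry// ltW. Qed.

Let LS_fin (f : cumulative R R) (A : set (measurableTypeR R)) :
  measurable A -> A `<=` D -> LS f A \is a fin_num.
Proof.
move=> mA AD; rewrite ge0_fin_numE//; apply: le_lt_trans (LSD_fin f).
by apply: le_measure => //; rewrite inE.
Qed.

(** The epsilon-delta condition of absolute continuity, transferred from families of intervals to
    sets of the ring. *)
Let ring_bound (e : R) : 0 < e -> exists2 d, 0 < d & forall B : set R,
  (ocitv_display R).-ring.-measurable (B : set (ocitv_type R)) ->
  B `<=` D -> (mu B < d%:E)%E -> (`|LS V B - LS W B| < e%:E)%E.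
Proof.
move=> /acF[d d0 dP]; exists d => // B mB.
have [n [x [y [xy txy ->]]]] := ocitv_ring_decomp mB.
move=> BD; rewrite /lebesgue_measure !lebesgue_stieltjes_disjoint_ocitv//.
rewrite lte_fin => lt_d.
rewrite -EFinB lte_fin -sumrB.
apply: le_lt_trans (ler_norm_sum _ _ _) _.
rewrite (eq_bigr (fun i => `|V (y i) - W (y i) - (V (x i) - W (x i))|)); last first.
  by move=> i _; congr `|_|; ring.
apply: (dP _ x y) => //.
- move=> i.
  have xyD z : x i < z <= y i -> 0 < z <= T.
    by move=> zi; have : D z by [apply: BD; exists i => //=; rewrite in_itv]; rewrite /D/= in_itv.
  split; last 2 first.
  + exact: ltW.
  + by have := xyD (y i); rewrite xy lexx => /(_ isT)/andP[].
  (* If x i < 0, then min(0, y i) would be a nonpositive point of ]x i, y i], which lies in ]0,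
     T]. *)
  + rewrite leNgt; apply/negP => xi0.
    have /xyD/andP[+ _] : x i < Num.min 0 (y i) <= y i.
      by rewrite lt_min xi0 xy ge_min lexx orbT.
    by rewrite lt_min ltxx.
- move=> i j _ _ [z [zi zj]]; apply: txy => //.
  by exists z; split; exact: subset_itv_oo_oc.
Qed.

(** Its Stieltjes measure is the sum of Lebesgue measure and those of V and W, so a cover that is
    tight for [G] is tight for all three at once. *)
Let G := (fun t => t + V t + W t).
Let G_nd : nondecreasing G.
Proof.
move=> x y xy; rewrite /G !lerD//; exact: cumulative_is_nondecreasing.
Qed.
Let G_rc : right_continuous G.
Proof.
move=> x; apply: cvgD; [apply: cvgD|];
 [exact: cvg_within|exact: cumulative_is_right_continuous|exact: cumulative_is_right_continuous].
Qed.
HB.instance Definition _ := isCumulative.Build R _ R G G_nd G_rc.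

Let LS_G A : measurable A -> LS G A = (mu A + LS V A + LS W A)%E.
Proof.
pose m : {measure set (measurableTypeR R) -> \bar R} :=
  measure_add (measure_add mu (LS V)) (LS W).
have mE X : m X = (mu X + LS V X + LS W X)%E by rewrite [LHS]measure_addE; congr (_ + _)%E; exact: measure_addE.
move=> mA; rewrite -mE.
apply: lebesgue_stieltjes_measure_unique => // X.
rewrite mE => /ocitvP[->|[[x y]/= xy ->]].
  by rewrite !measure0 !adde0.
rewrite /lebesgue_measure !lebesgue_stieltjes_itv_oc ?ltW// -!EFinD; congr EFin; rewrite /= /idfun /G.
by ring.
Qed.


(** Cover the null set E tightly by a countable union Y of half-open intervals. Its finite partial
    unions have Lebesgue measure below d, so V and W nearly agree on them and, in the limit, on Y;
    the excess of Y over E is small for both measures. *)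
Let LS_eq (E : set (measurableTypeR R)) : measurable E -> E `<=` D -> mu E = 0 ->
  LS V E = LS W E.
Proof.
move=> mE ED muE.
have VE := LS_fin V mE ED; have WE := LS_fin W mE ED; have GE := LS_fin G mE ED.
have near_eq e : 0 < e -> `|fine (LS V E) - fine (LS W E)| <= e.
  move=> e0.
  have e20 : 0 < e / 2 by rewrite divr_gt0.
  have [d d0 dP] := ring_bound e20.
  have de0 : 0 < Num.min d (e / 2) by rewrite lt_min d0.
  (* The Stieltjes measure is an outer measure, an infimum over countable covers. The margin d keeps
     mu Y below d; the margin e / 2 bounds the V- and W-measures of Y minus E. *)
  have : (LS G E < LS G E + (Num.min d (e / 2))%:E)%E by rewrite lteDl.
  move=> /ereal_inf_lt[_ [F [mF EF] <-] Flt].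
  pose U n : set R := (\big[setU/set0]_(k < n) F k) `&` D.
  have rU n : (ocitv_display R).-ring.-measurable (U n : set (ocitv_type R)).
    apply: measurableI; last by apply: SetRing.measurable_subring; exact: is_ocitv.
    by apply: bigsetU_measurable => k _; apply: SetRing.measurable_subring; exact: mF.
  have mFs k : measurable (F k : set (measurableTypeR R)).
    by apply: sub_sigma_algebra; exact: mF.
  have mU n : measurable (U n : set (measurableTypeR R)).
    by apply: measurableI => //; exact: bigsetU_measurable.
  pose Y : set (measurableTypeR R) := \bigcup_n U n.
  have mY : measurable Y by exact: bigcup_measurable.
  have YD : Y `<=` D by move=> x [n _ []].
  have YF : Y `<=` \bigcup_k F k.
    by move=> x [n _ [+ _]]; rewrite -bigcup_mkord => -[k _ Fkx]; exists k.
  have EY : E `<=` Y.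
    move=> x Ex; have [k _ Fkx] := EF _ Ex; exists k.+1 => //; split; last exact: ED.
    by rewrite -bigcup_mkord; exists k => //=.
  have YE : Y `&` E = E by apply/setIidPr.
  have LSY : (LS G Y < LS G E + (Num.min d (e / 2))%:E)%E.
    apply: le_lt_trans Flt; apply: le_trans (measure_sigma_subadditive _ mFs mY YF) _.
    apply: lee_nneseries => // k _.
    suff : (LS G (F k) <= wlength G (F k))%E by [].
    suff -> : LS G (F k) = wlength G (F k) by [].
    by apply: measurable_mu_extE; exact: mF.
  have mYE : measurable (Y `\` E) by exact: measurableD.
  have YED : Y `\` E `<=` D by move=> x [/YD].
  have LSYE : (mu (Y `\` E) + LS V (Y `\` E) + LS W (Y `\` E) < (Num.min d (e / 2))%:E)%E.
    rewrite -LS_G// measureD//; last by rewrite -ge0_fin_numE// LS_fin.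
    by rewrite YE lteBlDl.
  have splitY (m : {measure set (measurableTypeR R) -> \bar R}) :
      m Y = (m (Y `\` E) + m E)%E.
    by rewrite (measureDI m mY mE) YE.
  have muY : (mu Y < d%:E)%E.
    rewrite (splitY mu) [X in (_ + X)%E](_ : _ = 0%E) ?adde0; last exact: muE.
    apply: (@lt_le_trans _ _ (Num.min d (e / 2))%:E).
      by apply: le_lt_trans LSYE; rewrite -addeA leeDl// adde_ge0.
    by rewrite lee_fin ge_min lexx.
  have UY n : U n `<=` Y by move=> x Ux; exists n.
  have bU n : (`|LS V (U n) - LS W (U n)| < (e / 2)%:E)%E.
    apply: dP => //; first exact: subset_trans YD.
    by apply: le_lt_trans muY; apply: le_measure; rewrite ?inE.
  have Und : {homo U : n m / (n <= m)%N >-> (n <= m)%O}.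
    move=> n m nm; apply/subsetPset; apply: setSI; exact: subset_bigsetU.
  have cvU (f : cumulative R R) : LS f (U n) @[n --> \oo] --> LS f Y.
    exact: nondecreasing_cvg_mu.
  have cvVW : (`|LS V (U n) - LS W (U n)| @[n --> \oo] --> `|LS V Y - LS W Y|)%E.
    apply: cvg_abse; apply: cvgeB; [|exact: cvU|exact: cvU].
    by rewrite fin_num_adde_defr// LS_fin.
  have bY : (`|LS V Y - LS W Y| <= (e / 2)%:E)%E.
    rewrite -(cvg_lim _ cvVW)//; apply: lime_le; first by apply/cvg_ex; eexists; exact: cvVW.
    by apply: nearW => n; exact: ltW.
  have fV := LS_fin V mYE YED; have fW := LS_fin W mYE YED.
  have VY : LS V Y = (LS V (Y `\` E) + LS V E)%E by exact: splitY.
  have WY : LS W Y = (LS W (Y `\` E) + LS W E)%E by exact: splitY.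
  move: bY LSYE; rewrite VY WY.
  rewrite -(fineK VE) -(fineK WE) -(fineK fV) -(fineK fW) -!EFinD lee_fin.
  have muYE : mu (Y `\` E) \is a fin_num.
    by rewrite ge0_fin_numE//; apply: le_lt_trans (lt_trans muY (ltry d)); apply: le_measure; rewrite ?inE.
  rewrite -(fineK muYE) -!EFinD lte_fin lt_min => bY /andP[_].
  have : 0 <= fine (mu (Y `\` E)) by exact: fine_ge0.
  have : 0 <= fine (LS V (Y `\` E)) by exact: fine_ge0.
  have : 0 <= fine (LS W (Y `\` E)) by exact: fine_ge0.
  by move: bY; rewrite !ler_norml => /andP[b1 b2] *; apply/andP; split; lra.
rewrite -(fineK VE) -(fineK WE); congr EFin; apply/eqP; rewrite -subr_eq0 -normr_eq0.
rewrite eq_le normr_ge0 andbT; apply/ler_addgt0Pr => e e0; rewrite add0r.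
exact: near_eq.
Qed.

Let nuV := charge_of_finite_measure (mfrestr mD (LSD_fin V)).
Let nuW := charge_of_finite_measure (mfrestr mD (LSD_fin W)).
Let nu : {charge set (measurableTypeR R) -> \bar R} := cadd nuV (copp nuW).

Let nuE (A : set (measurableTypeR R)) : nu A = (LS V (A `&` D) - LS W (A `&` D))%E.
Proof. by []. Qed.

Let nu_dom : nu `<< mu.
Proof.
apply/null_content_dominatesP => A mA muA.
have mAD : measurable (A `&` D) by exact: measurableI.
rewrite nuE LS_eq ?subee//; first exact: LS_fin.
by apply/eqP; rewrite -measure_le0 -muA; apply: le_measure; rewrite ?inE.
Qed.

(** The charge [nu], the difference of the two Stieltjes measures on ]0, T], is dominated by
    Lebesgue measure; its Radon-Nikodym derivative, integrated over ]0, t], gives the increment of V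
    - W. *)
Lemma difference_density : exists2 w : R -> R, mu.-integrable setT (EFin \o w) &
  forall t, 0 <= t <= T -> V t - W t = V 0 - W 0 + \int[mu]_(s in `[0, t]) w s.
Proof.
pose w := Radon_Nikodym nu mu.
have wfin x : w x \is a fin_num by exact: Radon_Nikodym_fin_num.
have wE : EFin \o (fine \o w) = w by apply/funext => x /=; rewrite fineK.
have iw : mu.-integrable setT w by exact: Radon_Nikodym_integrable.
exists (fine \o w) => [|t /andP[t0 tT]]; first by rewrite wE.
have mt : measurable (`]0, t]%classic : set (measurableTypeR R)).
  by apply: sub_sigma_algebra; exact: is_ocitv.
have := Radon_Nikodym_integral nu_dom mt.
rewrite nuE (_ : `]0, t] `&` D = `]0, t])%classic; last first.
  apply/setIidPl; apply: subset_itvl; by rewrite bnd_simp.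
rewrite !lebesgue_stieltjes_itv_oc// -EFinB => e.
have mw : measurable_fun `]0, t] (fine \o w).
  by apply/measurable_EFinP; rewrite wE; apply: measurable_funTS; exact: measurable_int iw.
rewrite /Rintegral -integral_itv_obnd_cbnd//.
rewrite (_ : (fun s => ((fine \o w) s)%:E) = w)// -e/=; first lra.
exact/measurable_EFinP.
Qed.

End charge_of_difference.

(** * Absolutely continuous functions are integrals *)

Section abs_cont_FTC.
Context {R : realType}.
Variables (T : R) (H : R -> R).
Hypotheses (T0 : 0 < T) (acH : abs_cont_on 0 T H).

Notation mu := (@lebesgue_measure R).
(** [TVH] and [W] form the Jordan decomposition of H, frozen outside [0, T] so that both are
    cumulative functions on the whole line. *)
Let TVH (x : R) : R := fine (total_variation 0 (clamp T x) H).
Let W (x : R) : R := TVH x - H (clamp T x).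

Let TV_fin (x : R) : 0 <= x <= T -> total_variation 0 x H \is a fin_num.
Proof.
move=> /andP[x0 xT]; apply/bounded_variationP => //.
exact: bounded_variationl xT (abs_cont_BV T0 acH).
Qed.

Let TV_sub x y : x <= y -> `|H (clamp T y) - H (clamp T x)| <= TVH y - TVH x.
Proof.
move=> xy; have xT := clamp_itv x (ltW T0); have yT := clamp_itv y (ltW T0).
have /andP[x0 _] := xT; have cxy := clamp_nd T xy.
rewrite /TVH (total_variationD H x0 cxy) fineD ?TV_fin//; last first.
  apply/bounded_variationP => //; have /andP[_ yT'] := yT.
  apply: bounded_variationr x0 cxy _.
  by apply: bounded_variationl yT' (abs_cont_BV T0 acH); case/andP : yT.
have fc : total_variation (clamp T x) (clamp T y) H \is a fin_num.
  apply/bounded_variationP => //; have /andP[y0 yT'] := yT.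
  by apply: (bounded_variationr x0 cxy); exact: bounded_variationl yT' (abs_cont_BV T0 acH).
by rewrite addrAC subrr add0r -lee_fin fineK//; exact: total_variation_ge.
Qed.

Let TV_nd : nondecreasing TVH.
Proof. by move=> x y /TV_sub h; rewrite -subr_ge0 (le_trans _ h). Qed.

Let TV_c : continuous TVH.
Proof.
apply: (clamp_continuous T0 (f := fine \o total_variation 0 ^~ H)).
apply: total_variation_continuous => //; first exact: abs_cont_within_continuous.
exact: abs_cont_BV.
Qed.

Let TV_rc : right_continuous TVH.
Proof. exact: right_continuousW. Qed.

Let W_nd : nondecreasing W.
Proof.
move=> x y /TV_sub; rewrite /W => h.
by have := le_trans (ler_norm _) h; lra.
Qed.

Let W_rc : right_continuous W.
Proof.
apply: right_continuousW => x; apply: cvgB; first exact: TV_c.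
exact: abs_cont_clamp_continuous.
Qed.

HB.instance Definition _ := isCumulative.Build R _ R TVH TV_nd TV_rc.
HB.instance Definition _ := isCumulative.Build R _ R W W_nd W_rc.

Lemma abs_cont_density : exists2 w : R -> R, mu.-integrable setT (EFin \o w) &
  forall t, 0 <= t <= T -> H t = H 0 + \int[mu]_(s in `[0, t]) w s.
Proof.
have HE x : 0 <= x <= T -> TVH x - W x = H x.
  by move=> xT; rewrite /W clamp_id//; lra.
have acVW : abs_cont_on 0 T (fun t => TVH t - W t).
  move=> e /acH[d d0 dP]; exists d => // n x y xy txy sd.
  rewrite (eq_bigr (fun i => `|H (y i) - H (x i)|)); first exact: dP.
  move=> i _; have [x0 xyi yT] := xy i.
  by rewrite !HE// ?x0 ?yT ?(le_trans x0)// (le_trans xyi).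
have [w iw wE] := difference_density T0 acVW.
exists w => // t tT.
by have := wE t tT; rewrite !HE// lexx ltW.
Qed.

End abs_cont_FTC.

(** * Almost everywhere differentiation of integrals *)

Section FTC_ae.
Context {R : realType}.
Notation mu := (@lebesgue_measure R).

(** The endpoints are negligible, and at them a two-sided derivative would depend on values outside
    [0, T]. *)
Lemma ae_interior_itv (T : R) (P : R -> Prop) :
  {ae mu, forall t, t \in `]0, T[ -> P t} -> {ae mu, forall t, t \in `[0, T] -> P t}.
Proof.
move=> h; have n0 x : mu.-negligible [set x].
  by apply/negligibleP; [exact: measurable_set1|exact: lebesgue_measure_set1].
have : mu.-negligible (~` [set t | t \in `]0, T[ -> P t] `|` ([set 0] `|` [set T])).
  by apply: negligibleU => //; exact: negligibleU.
apply: negligibleS => t /= tP; apply: contrapT => /not_orP[/contrapT h1 /not_orP[t0 tT]].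
apply: tP; rewrite in_itv/= => /andP[t0' tT']; apply: h1; rewrite in_itv/=.
by rewrite !lt_neqAle t0' tT' eq_sym !andbT; apply/andP; split; apply/eqP.
Qed.

Lemma ae_derive_integral (T K : R) (H w : R -> R) :
  mu.-integrable `[0, T] (EFin \o w) ->
  (forall t, 0 <= t <= T -> H t = K + \int[mu]_(s in `[0, t]) w s) ->
  {ae mu, forall t, t \in `[0, T] -> derive1 H t = w t}.
Proof.
move=> iw HE; apply: ae_interior_itv.
pose w' := w \_ `[0, T].
have iw' : mu.-integrable setT (EFin \o w').
  by rewrite -restrict_EFin; apply/integrable_restrict => //=; rewrite setTI.
have := @FTC1 R w' (BLeft 0).
have iw'S y : mu.-integrable [set` Interval (BLeft 0) (BRight y)] (EFin \o w').
  by apply: integrableS iw'.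
move=> /(_ iw'S (integrable_locally (measurable_itv _) iw)).
apply: filterS; first exact: (ae_filter_ringOfSetsType mu).
move=> x /= + x0T; move: x0T; rewrite in_itv/= => /andP[x0 xT].
rewrite lte_fin => /(_ x0)[dF F'].
set F := fun x : R => _ in dF F'.
(* At an interior point the derivative depends only on H inside ]0, T[, where H is a constant plus
   the primitive of w. *)
have HF : \forall y \near x, H y = (cst K \+ F) y.
  have : x \in `]0, T[ by rewrite in_itv/= x0.
  move=> /near_in_itvoo; apply: filterS => y; rewrite in_itv/= => /andP[y0 yT].
  rewrite HE ?ltW//=; congr (_ + _); apply: eq_Rintegral => s.
  rewrite inE/= in_itv/= => /andP[s0 sy].
  by rewrite /w' patchE mem_set//= in_itv/= s0 (le_trans sy) ?ltW.
rewrite derive1E (near_eq_derive _ HF) deriveD; [|exact: derivable_cst|exact: dF].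
rewrite derive_cst add0r -derive1E F' /w' patchE mem_set//=.
by rewrite in_itv/= !ltW.
Qed.

End FTC_ae.

Lemma lebesgue_aeS (R : realType) (P Q : R -> Prop) : (forall x, P x -> Q x) ->
  {ae @lebesgue_measure R, forall x, P x} -> {ae @lebesgue_measure R, forall x, Q x}.
Proof. by move=> PQ; apply: filterS => //; exact: (ae_filter_ringOfSetsType lebesgue_measure). Qed.

Lemma lebesgue_aeS2 (R : realType) (P Q S : R -> Prop) : (forall x, P x -> Q x -> S x) ->
  {ae @lebesgue_measure R, forall x, P x} -> {ae @lebesgue_measure R, forall x, Q x} ->
  {ae @lebesgue_measure R, forall x, S x}.
Proof. by move=> PQ; apply: filterS2 => //; exact: (ae_filter_ringOfSetsType lebesgue_measure). Qed.

(** * Invariance of Lebesgue integrals under reflection and translation *)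

Section reflection.
Context {R : realType}.
Notation mu := (@lebesgue_measure R).

Let reflect_measurable (t : R) : measurable_fun [set: R] (fun s => t - s).
Proof. exact: measurable_funB. Qed.

Lemma lebesgue_measure_reflect (t : R) (A : set R) : measurable A ->
  mu [set s | A (t - s)] = mu A.
Proof.
move=> mA.
pose f (s : measurableTypeR R) : measurableTypeR R := t - s.
have mf : measurable_fun setT f by exact: reflect_measurable.
pose phi : {mfun _ >-> _} := HB.pack f (isMeasurableFun.Build _ _ _ _ _ mf).
apply/esym; have := @lebesgue_measure_unique R (pushforward mu phi); apply => //.
move=> _ [[x y] _ <-]/=; rewrite /pushforward.
have -> : phi @^-1` `]x, y]%classic = `[t - y, t - x[%classic.
  by apply/seteqP; split => s /=; rewrite !in_itv/= /f => /andP[h1 h2]; apply/andP; split; lra.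
rewrite !lebesgue_measure_itv/= !lte_fin ltrD2l ltrN2.
by case: ifP => // _; rewrite -!EFinD; congr EFin; ring.
Qed.

Lemma ge0_integral_reflect (t : R) (f : measurableTypeR R -> \bar R) :
  measurable_fun setT f -> (forall x, 0 <= f x)%E ->
  (\int[mu]_s f (t - s)%R = \int[mu]_s f s)%E.
Proof.
move=> mf f0.
pose phi (s : measurableTypeR R) : measurableTypeR R := t - s.
have mphi : measurable_fun setT phi by exact: reflect_measurable.
have := ge0_integral_pushforward mphi mu measurableT mf (fun y _ => f0 y).
rewrite preimage_setT /= => <-.
by apply: eq_measure_integral => A mA _; exact: lebesgue_measure_reflect.
Qed.

Lemma integral_reflect (t : R) (f : measurableTypeR R -> \bar R) : measurable_fun setT f ->
  (\int[mu]_s f (t - s)%R = \int[mu]_s f s)%E.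
Proof.
move=> mf; rewrite integralE [RHS]integralE; congr (_ - _)%E.
- transitivity (\int[mu]_s f^\+ (t - s)%R)%E; first by apply: eq_integral => s _; rewrite ?funeposE ?funenegE.
  by apply: ge0_integral_reflect => //; exact: measurable_funepos.
- transitivity (\int[mu]_s f^\- (t - s)%R)%E; first by apply: eq_integral => s _; rewrite ?funeposE ?funenegE.
  by apply: ge0_integral_reflect => //; exact: measurable_funeneg.
Qed.

(** A translation is the composite of two reflections. *)
Lemma integral_shift (r : R) (f : R -> \bar R) : measurable_fun setT f ->
  (\int[mu]_s f (s - r)%R = \int[mu]_s f s)%E.
Proof.
move=> mf; rewrite -(integral_reflect r (f := fun s => f (s - r)%R)); last first.
  by apply: measurableT_comp => //; exact: measurable_funB.
rewrite -[RHS](integral_reflect 0)//; apply: eq_integral => s _; congr f; ring.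
Qed.

End reflection.

(** * Convolution of nonnegative functions *)

Section convolution.
Context {R : realType}.
Notation mu := (@lebesgue_measure R).
Local Open Scope ereal_scope.

Definition econv (F G : R -> \bar R) (t : R) : \bar R := \int[mu]_s (F (t - s)%R * G s).

Lemma measurable_conv_kernel (F G : R -> \bar R) :
  measurable_fun setT F -> measurable_fun setT G ->
  measurable_fun setT (fun z : R * R => F (z.1 - z.2)%R * G z.2).
Proof.
move=> mF mG; apply: emeasurable_funM.
  by apply: measurableT_comp => //; exact: measurable_funB.
by apply: measurableT_comp.
Qed.

Variables F G : R -> \bar R.
Hypotheses (mF : measurable_fun setT F) (mG : measurable_fun setT G).
Hypotheses (F0 : forall x, 0 <= F x) (G0 : forall x, 0 <= G x).

Lemma econv_ge0 t : 0 <= econv F G t.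
Proof. by apply: integral_ge0 => s _; exact: mule_ge0. Qed.

Lemma measurable_econv : measurable_fun setT (econv F G).
Proof.
have := @measurable_fun_fubini_tonelli_F _ _ _ _ R mu
  (fun z : R * R => F (z.1 - z.2)%R * G z.2) (measurable_conv_kernel mF mG).
by apply => z; exact: mule_ge0.
Qed.

Lemma integral_econv : \int[mu]_t econv F G t = (\int[mu]_t F t) * (\int[mu]_t G t).
Proof.
transitivity (\int[mu]_s \int[mu]_t (F (t - s)%R * G s)).
  have := @fubini_tonelli _ _ _ _ R mu mu (fun z : R * R => F (z.1 - z.2)%R * G z.2)
    (measurable_conv_kernel mF mG).
  by apply => z; exact: mule_ge0.
rewrite -ge0_integralZl//; last exact: integral_ge0.
apply: eq_integral => s _.
rewrite ge0_integralZr//; first by rewrite integral_shift.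
by apply: measurableT_comp => //; exact: measurable_funB.
Qed.

(** By Tonelli the integral of the convolution is the product of the two integrals; an integrable
    function is finite a.e. *)
Lemma econv_lty : \int[mu]_t F t < +oo -> \int[mu]_t G t < +oo ->
  {ae mu, forall t, econv F G t < +oo}.
Proof.
move=> iF iG.
have : mu.-integrable setT (econv F G).
  apply/integrableP; split; first exact: measurable_econv.
  under eq_integral => x _ do rewrite gee0_abs ?econv_ge0//.
  rewrite integral_econv; apply: lte_mul_pinfty => //; first exact: integral_ge0.
  by rewrite ge0_fin_numE//; exact: integral_ge0.
move/integrable_ae => /(_ measurableT); by apply: filterS => t /(_ I); rewrite ge0_fin_numE// econv_ge0.
Qed.

End convolution.

(** * Convolving with the other member of a Sonine pair *)

Section sonine_inversion.
Context {R : realType}.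
Notation mu := (@lebesgue_measure R).
Local Open Scope ereal_scope.

Lemma integral_support (D : set R) (f : R -> \bar R) :
  (forall x, ~ D x -> f x = 0) -> \int[mu]_x f x = \int[mu]_(x in D) f x.
Proof.
move=> f0; rewrite [RHS]integral_mkcond; apply: eq_integral => x _.
by rewrite patchE; case: ifPn => //; rewrite notin_setE => /f0.
Qed.

Variables (T : R) (k1 k2 psi X : R -> R).
Hypotheses (i1 : mu.-integrable setT (EFin \o k1))
  (i2 : mu.-integrable setT (EFin \o k2)) (ip : mu.-integrable setT (EFin \o psi)).
Hypotheses (k10 : forall x, (x < 0)%R -> k1 x = 0%R)
  (k20 : forall x, (x < 0)%R -> k2 x = 0%R) (psi0 : forall x, (x < 0)%R -> psi x = 0%R).

Let m1 : measurable_fun setT k1. Proof. by apply/measurable_EFinP; exact: measurable_int i1. Qed.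
Let m2 : measurable_fun setT k2. Proof. by apply/measurable_EFinP; exact: measurable_int i2. Qed.
Let mp : measurable_fun setT psi. Proof. by apply/measurable_EFinP; exact: measurable_int ip. Qed.

Let ab (f : R -> R) (x : R) : \bar R := `|(f x)%:E|.

Let mab f : measurable_fun setT f -> measurable_fun setT (ab f).
Proof. by move=> mf; apply: measurableT_comp => //; exact/measurable_EFinP. Qed.

Let ab0 f x : 0 <= ab f x. Proof. exact: abse_ge0. Qed.

Let slices (f : R -> R) : mu.-integrable setT (EFin \o f) ->
  measurable_fun setT f /\ \int[mu]_x ab f x < +oo.
Proof. by move=> /integrableP[mf jf]; split => //; exact/measurable_EFinP. Qed.

Lemma ae_integrable_conv :
  {ae mu, forall s, mu.-integrable setT (fun r => (k2 (s - r) * psi r)%:E)}.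
Proof.
have [_ j2] := slices i2; have [_ jp] := slices ip.
have := econv_lty (mab m2) (mab mp) (ab0 k2) (ab0 psi) j2 jp.
apply: lebesgue_aeS => s; rewrite /econv => lty; apply/integrableP; split.
  apply/measurable_EFinP; apply: measurable_funM => //.
  by apply: measurableT_comp => //; exact: measurable_funB.
by under eq_integral do rewrite EFinM abseM.
Qed.

Hypothesis P : forall t, (0 < t <= T)%R ->
  volterra_conv_defined k1 k2 t /\ volterra_conv k1 k2 t = 1%R.
Hypotheses (mX : measurable_fun setT X) (X0 : forall x, (x < 0)%R -> X x = 0%R).
Hypothesis XE : {ae mu, forall s, s \in `[0%R, T] ->
  \int[mu]_r (k2 (s - r) * psi r)%:E = (X s)%:E}.

Let kernel (t s r : R) : R := (k1 (t - s) * (k2 (s - r) * psi r))%R.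

(** Shifting s by r turns the integral into the Sonine convolution at t - r, which is 1 for r < t;
    for r > t one of the two kernels has a negative argument. The point r = t is excluded because
    the Sonine identity fails at 0. *)
Let kernel_int_s (t r : R) : (0 <= t <= T)%R -> r != t ->
  \int[mu]_s (kernel t s r)%:E = (psi r)%:E * (\1_(`[0%R, t]) r)%:E.
Proof.
move=> /andP[t0 tT] rt; have [r0|r0] := ltP r 0%R.
  rewrite psi0// mul0e /kernel psi0//; under eq_integral do rewrite !mulr0.
  exact: integral0.
have [tr|rlet] := ltP t r.
  rewrite indicE memNset ?mule0; last by rewrite /= in_itv/= r0/= leNgt tr.
  apply: integral0_eq => s _; rewrite /kernel.
  have [ts|st] := ltP t s; first by rewrite k10 ?mul0r// subr_lt0.
  by rewrite k20 ?mul0r ?mulr0// subr_lt0 (le_lt_trans st).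
have tr0 : (0 < t - r)%R by rewrite subr_gt0 lt_neqAle rt.
rewrite indicE mem_set/=; last by rewrite in_itv/= r0.
rewrite mule1.
pose f s : \bar R := (k1 (t - r - s) * k2 s * psi r)%:E.
have mf : measurable_fun setT f.
  apply/measurable_EFinP; apply: measurable_funM => //; apply: measurable_funM => //.
  by apply: measurableT_comp => //; exact: measurable_funB.
transitivity (\int[mu]_s f (s - r)%R).
  apply: eq_integral => s _; rewrite /f /kernel mulrA; congr (_ * _ * _)%:E; congr k1.
  by rewrite opprB addrA subrK.
rewrite integral_shift// (integral_support (D := `[0%R, (t - r)%R])); last first.
  move=> s /=; rewrite in_itv/= => /negP; rewrite negb_and -!ltNge /f.
  by move=> /orP[s0|s0]; [rewrite k20// mulr0 mul0r|rewrite k10 ?mul0r// subr_lt0].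
have /P[def conv1] : (0 < t - r <= T)%R.
  by rewrite tr0/= (le_trans _ tT)// gerBl.
rewrite /f; under eq_integral do rewrite EFinM.
rewrite integralZr//.
have -> : \int[mu]_(s in `[0%R, (t - r)%R]) (k1 (t - r - s) * k2 s)%:E = 1.
  by rewrite -[LHS]fineK ?(integrable_fin_num _ def)//; congr EFin.
by rewrite mul1e.
Qed.

(** This is associativity: k1 * (k2 * psi) = (k1 * k2) * psi = 1 * psi. The function [X] is any
    measurable representative of k2 * psi on [0, T]. *)
Lemma sonine_inversion : {ae mu, forall t, t \in `[0%R, T] ->
  \int[mu]_s (k1 (t - s) * X s)%:E = \int[mu]_(r in `[0%R, t]) (psi r)%:E}.
Proof.
have [_ j1] := slices i1; have [_ j2] := slices i2; have [_ jp] := slices ip.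
have m12 := measurable_econv (mab m2) (mab mp) (ab0 k2) (ab0 psi).
have ge12 := econv_ge0 (ab0 k2) (ab0 psi).
have j12 : \int[mu]_s econv (ab k2) (ab psi) s < +oo.
  rewrite integral_econv//; [|exact: mab|exact: mab].
  by apply: lte_mul_pinfty => //; [exact: integral_ge0|rewrite ge0_fin_numE//; exact: integral_ge0].
(* For a.e. t the triple convolution of absolute values is finite, which is the integrability that
   Fubini needs. *)
have := econv_lty (mab m1) m12 (ab0 k1) ge12 j1 j12.
apply: lebesgue_aeS => t Mt; rewrite in_itv/= => /andP[t0 tT].
pose g (z : R * R) : \bar R := (kernel t z.1 z.2)%:E.
have mg : measurable_fun setT g.
  apply/measurable_EFinP; apply: measurable_funM.
    by apply: measurableT_comp => //; exact: measurable_funB.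
  apply: measurable_funM; last exact: measurableT_comp.
  by apply: measurableT_comp => //; exact: measurable_funB.
have ig : (mu \x mu).-integrable setT g.
  apply/integrable12ltyP => //.
  apply: le_lt_trans Mt; rewrite le_eqVlt; apply/orP; left; apply/eqP.
  apply: eq_integral => s _.
  rewrite /econv -ge0_integralZl//; last 2 first.
  - apply: emeasurable_funM; last exact: mab.
    by apply: measurableT_comp; [exact: mab|exact: measurable_funB].
  - by move=> r _; exact: mule_ge0.
  by apply: eq_integral => r _; rewrite /ab -!abseM -!EFinM.
transitivity (\int[mu]_s \int[mu]_r g (s, r)).
  apply: ae_eq_integral => //.
  - apply/measurable_EFinP; apply: measurable_funM => //.
    by apply: measurableT_comp => //; exact: measurable_funB.
  - exact: (measurable_fubini_F ig).
  apply: lebesgue_aeS2 XE ae_integrable_conv => s Xs is_ _.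
  (* [XE] is only available on [0, T]; for s < 0 and for s > t both sides vanish. *)
  have [s0|s0] := ltP s 0%R.
    rewrite X0// mulr0; apply/esym/integral0_eq => r _; rewrite /g/= /kernel.
    have [r0|r0] := ltP r 0%R; first by rewrite psi0// !mulr0.
    by rewrite k20 ?mul0r ?mulr0// subr_lt0 (lt_le_trans s0).
  have [ts|st] := ltP t s.
    by rewrite k10 ?subr_lt0// mul0r; apply/esym/integral0_eq => r _;
      rewrite /g/= /kernel k10 ?subr_lt0// mul0r.
  rewrite EFinM -Xs ?in_itv/= ?s0 ?(le_trans st)// -integralZl//.
transitivity (\int[mu]_r \int[mu]_s g (s, r)); first exact: (Fubini ig).
transitivity (\int[mu]_r ((psi r)%:E * (\1_(`[0%R, t]) r)%:E)).
  apply: ae_eq_integral => //.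
  - exact: (measurable_fubini_G ig).
  - apply: emeasurable_funM; first exact/measurable_EFinP.
    by apply/measurable_EFinP; exact: measurable_indic.
  have : mu.-negligible [set t].
    by apply/negligibleP; [exact: measurable_set1|exact: lebesgue_measure_set1].
  apply: negligibleS => r /= + ; apply: contra_notP => rt _.
  by apply: kernel_int_s; [rewrite t0|apply/eqP].
rewrite (integral_support (D := `[0%R, t])); last first.
  by move=> r rt; rewrite indicE memNset// mule0.
apply: eq_integral => r rt; by rewrite indicE rt mule1.
Qed.

End sonine_inversion.

(** * Uniqueness of continuous representatives and of densities *)

Section zero_integral.
Context {R : realType}.
Notation mu := (@lebesgue_measure R).

(** If f and g differ at t, they differ on an open subinterval of [0, T] next to t, which has
    positive measure. *)
Lemma ae_eq_within_continuous (T : R) (f g : R -> R) : 0 < T ->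
  {within `[0, T], continuous f} -> {within `[0, T], continuous g} ->
  {ae mu, forall t, t \in `[0, T] -> f t = g t} ->
  forall t, 0 <= t <= T -> f t = g t.
Proof.
move=> T0 cf cg [N [mN N0 sN]] t tT; apply/eqP; rewrite -subr_eq0; apply/negPn/negP => fgt.
pose d x := f (clamp T x) - g (clamp T x).
have cd : continuous d.
  move=> x; apply: cvgB; first exact: (clamp_continuous T0 cf).
  exact: (clamp_continuous T0 cg).
have dt : 0 < `|d t| by rewrite /d clamp_id// normr_gt0.
have /cvgrPdist_lt/(_ _ dt)[e /= e0 eP] := cd t.
(* The interval is taken to the right of t when t < T and to the left when t = T. *)
have [x [y [xy xyT xyt]]] : exists x y, [/\ x < y, `]x, y[ `<=` `[0, T] & `]x, y[ `<=` ball t e].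
  have /andP[t0 tT'] := tT; have [tltT|] := ltP t T.
    exists t, (Num.min T (t + e)); split.
    - by rewrite lt_min tltT ltrDl.
    - move=> z /=; rewrite !in_itv/= lt_min => /and3P[tz zT _].
      by rewrite (le_trans t0) ?ltW.
    - move=> z /=; rewrite !in_itv/= lt_min => /and3P[tz zT ze].
      by rewrite /ball/= ltr0_norm ?subr_lt0// opprB ltrBlDl.
  move=> Tt; exists (Num.max 0 (t - e)), t; split.
  - by rewrite gt_max (lt_le_trans T0)// ltrBlDr ltrDl.
  - move=> z /=; rewrite !in_itv/= gt_max => /andP[/andP[z0 _] zt].
    by rewrite ltW//= (le_trans (ltW zt)).
  - move=> z /=; rewrite !in_itv/= gt_max => /andP[/andP[z0 ez] zt].
    by rewrite /ball/= gtr0_norm ?subr_gt0// ltrBlDr -ltrBlDl.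
have : (mu `]x, y[ <= mu N)%E.
  apply: le_measure; rewrite ?inE//=.
  move=> z zxy; apply: sN => fgz; have zT := xyT _ zxy; have := eP _ (xyt _ zxy).
  by rewrite {2}/d (clamp_id zT) fgz// subrr subr0 ltxx.
by rewrite N0 lebesgue_measure_itv/= lte_fin xy -EFinB lee_fin subr_le0 leNgt xy.
Qed.

Lemma within_continuous_integral (T : R) (w : R -> R) : 0 <= T ->
  mu.-integrable `[0, T] (EFin \o w) ->
  {within `[0, T], continuous (fun t => \int[mu]_(s in `[0, t]) w s)}.
Proof. exact: parameterized_integral_continuous. Qed.

(** The primitive is continuous, so it vanishes everywhere, and its derivative is w a.e. *)
Lemma integral_eq0_ae_eq0 (T : R) (w : R -> R) : 0 < T ->
  mu.-integrable `[0, T] (EFin \o w) ->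
  {ae mu, forall t, t \in `[0, T] -> \int[mu]_(s in `[0, t]) w s = 0} ->
  {ae mu, forall t, t \in `[0, T] -> w t = 0}.
Proof.
move=> T0 iw w0.
have h := ae_eq_within_continuous T0 (within_continuous_integral (ltW T0) iw)
  (@continuous_subspaceT _ _ _ (cst 0) (@cst_continuous _ _ 0)) w0.
have := @ae_derive_integral R T 0 (cst 0) w iw.
have : forall t, 0 <= t <= T -> (cst 0 : R -> R) t = 0 + \int[mu]_(s in `[0, t]) w s.
  by move=> t /h ->; rewrite addr0.
move=> /[swap] /[apply]; apply: lebesgue_aeS => t /[apply] <-.
by rewrite derive1_cst.
Qed.

End zero_integral.

(** * Equivalence of c * phi = g and h * g = 1 * phi *)

Lemma integrable_conv_kernel (R : realType) (c phi : R -> R) :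
  (@lebesgue_measure R).-integrable setT (EFin \o c) ->
  (@lebesgue_measure R).-integrable setT (EFin \o phi) ->
  (@lebesgue_measure R \x @lebesgue_measure R)%E.-integrable setT
    (fun z : R * R => (c (z.1 - z.2) * phi z.2)%:E).
Proof.
set mu := @lebesgue_measure R.
move=> ic iphi.
have mEFin (f : R -> R) : mu.-integrable setT (EFin \o f) -> measurable_fun setT f.
  by move=> i; apply/measurable_EFinP; exact: measurable_int i.
have mk : measurable_fun setT (fun z : R * R => (c (z.1 - z.2) * phi z.2)%:E).
  apply/measurable_EFinP; apply: measurable_funM.
    by apply: measurableT_comp; [exact: mEFin|exact: measurable_funB].
  by apply: measurableT_comp; first exact: mEFin.
apply/integrable12ltyP => //.
have /integrableP[mc jc] := ic; have /integrableP[mphi jphi] := iphi.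
have mac : measurable_fun setT (fun x => `|(EFin \o c) x|%E) by exact: measurableT_comp.
have maphi : measurable_fun setT (fun x => `|(EFin \o phi) x|%E) by exact: measurableT_comp.
have e := integral_econv mac maphi (fun=> abse_ge0 _) (fun=> abse_ge0 _).
have : ((\int[mu]_t `|(EFin \o c) t|) * (\int[mu]_t `|(EFin \o phi) t|) < +oo)%E.
  apply: lte_mul_pinfty => //; first exact: integral_ge0.
  by rewrite ge0_fin_numE//; exact: integral_ge0.
rewrite -e; apply: le_lt_trans; rewrite le_eqVlt; apply/orP; left; apply/eqP.
apply: eq_integral => s _; apply: eq_integral => r _.
by rewrite /= normrM EFinM.
Qed.

Section sonine_equivalence.
Context {R : realType}.
Notation mu := (@lebesgue_measure R).

(** Substituting t - s for s. It makes the Sonine relation symmetric, so the inversion can be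
    applied with either member first. *)
Lemma volterra_convC (k g : R -> R) (t : R) :
  measurable_fun setT k -> measurable_fun setT g ->
  volterra_conv_defined k g t -> volterra_conv_defined g k t /\
  volterra_conv g k t = volterra_conv k g t.
Proof.
move=> mk mg def.
have mconv (f f' : R -> R) : measurable_fun setT f -> measurable_fun setT f' ->
    measurable_fun setT (fun s : R => f (t - s) * f' s).
  move=> mf mf'; apply: measurable_funM => //.
  by apply: measurableT_comp => //; exact: measurable_funB.
have mI : measurable (`[0, t] : set (measurableTypeR R)) by exact: measurable_itv.
have E (F : R -> \bar R) : measurable_fun setT F ->
    (\int[mu]_(s in `[0%R, t]) F (t - s)%R = \int[mu]_(s in `[0%R, t]) F s)%E.
  move=> mF; rewrite integral_mkcond [RHS]integral_mkcond.
  rewrite -[RHS](integral_reflect t); last first.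
    by apply/(measurable_restrictT _ _).1 => //; exact: measurable_funTS.
  apply: eq_integral => s _; rewrite !patchE.
  have -> : ((t - s)%R \in `[0, t]%classic) = (s \in `[0, t]%classic).
    by apply/idP/idP; rewrite !inE/= !in_itv/= => /andP[h1 h2]; apply/andP; split; lra.
  by [].
split.
  move/integrableP : def => [_ def]; apply/integrableP; split.
    by apply: measurable_funTS; apply/measurable_EFinP; exact: mconv.
  apply: le_lt_trans def; rewrite -[leRHS]E; last first.
    by apply: measurableT_comp => //; apply/measurable_EFinP; exact: mconv.
  rewrite le_eqVlt; apply/orP; left; apply/eqP.
  by apply: eq_integral => s _; rewrite subKr mulrC.
rewrite /volterra_conv /Rintegral; congr fine; rewrite -[RHS]E; last first.
  by apply/measurable_EFinP; exact: mconv.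
by apply: eq_integral => s _; rewrite subKr mulrC.
Qed.

Variables (T : R) (c h g phi : R -> R).
Hypotheses (T0 : 0 < T)
  (ic : mu.-integrable setT (EFin \o c)) (ih : mu.-integrable setT (EFin \o h))
  (ig : mu.-integrable setT (EFin \o g)) (iphi : mu.-integrable setT (EFin \o phi)).
Hypotheses (c0 : forall x, x < 0 -> c x = 0) (h0 : forall x, x < 0 -> h x = 0)
  (g0 : forall x, x < 0 -> g x = 0) (phi0 : forall x, x < 0 -> phi x = 0).
Hypothesis P : forall t, 0 < t <= T ->
  volterra_conv_defined c h t /\ volterra_conv c h t = 1.

Let mEFin (f : R -> R) : mu.-integrable setT (EFin \o f) -> measurable_fun setT f.
Proof. by move=> i; apply/measurable_EFinP; exact: measurable_int i. Qed.

Let P' t : 0 < t <= T -> volterra_conv_defined h c t /\ volterra_conv h c t = 1.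
Proof.
move=> /P[d e]; have [d' e'] := volterra_convC (mEFin ic) (mEFin ih) d.
by rewrite e'.
Qed.

(** Left to right is the inversion with h. For the converse, h * g and h * (c * phi) are both 1 *
    phi, and the inversion with c shows that h is injective under convolution. *)
Lemma sonine_equivalence :
  {ae mu, forall t, t \in `[0, T] ->
    (\int[mu]_s (c (t - s) * phi s)%:E = (g t)%:E)%E} <->
  {ae mu, forall t, t \in `[0, T] ->
    (\int[mu]_s (h (t - s) * g s)%:E = \int[mu]_(s in `[0%R, t]) (phi s)%:E)%E}.
Proof.
split=> [cphi|hg].
  exact: (sonine_inversion ih ic iphi h0 c0 phi0 P' (mEFin ig) g0 cphi).
pose y (s : R) : R := fine (\int[mu]_r (c (s - r) * phi r)%:E)%E.
have ikernel := integrable_conv_kernel ic iphi.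
have iF := integrable_fubini_F ikernel.
have iy : mu.-integrable setT (EFin \o y).
  apply/integrableP; have /integrableP[mF jF] := iF; split.
    by apply/measurable_EFinP; apply: measurableT_comp mF => //; exact: fine_measurable.
  apply: le_lt_trans jF; apply: ge0_le_integral => //.
  - by apply: measurableT_comp => //; apply/measurable_EFinP; apply: measurableT_comp mF => //; exact: fine_measurable.
  - exact: measurableT_comp.
  - by move=> x _; rewrite /y /fubini_F /=; case: (integral _ _ _) => //=; rewrite normr0 leey.
have y0 x : x < 0 -> y x = 0.
  move=> x0; rewrite /y integral0_eq// => r _.
  have [r0|r0] := ltP r 0; first by rewrite phi0// mulr0.
  by rewrite c0 ?mul0r// subr_lt0 (lt_le_trans x0).
have yE : {ae mu, forall s, s \in `[0, T] -> (\int[mu]_r (c (s - r) * phi r)%:E = (y s)%:E)%E}.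
  apply: lebesgue_aeS (ae_integrable_conv ic iphi) => s is_ _.
  by rewrite /y fineK//; exact: integrable_fin_num.
have hy := sonine_inversion ih ic iphi h0 c0 phi0 P' (mEFin iy) y0 yE.
(* Since h * d = 0 on [0, T], convolving with c shows that the primitive of d is 0. *)
pose d := (g \- y) \_ `[0, T].
have mT : measurable (`[0, T] : set (measurableTypeR R)) by exact: measurable_itv.
have igy : mu.-integrable setT (EFin \o (g \- y)).
  by apply: eq_integrable (integrableB measurableT ig iy) => // s _.
have id_ : mu.-integrable setT (EFin \o d).
  rewrite /d -restrict_EFin; apply/integrable_restrict => //=; rewrite setTI.
  exact: integrableS igy.
have hd : {ae mu, forall s, s \in `[0, T] ->
    (\int[mu]_r (h (s - r) * d r)%:E = (cst 0 s)%:E)%E}.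
  have both P1 P2 (A1 : {ae mu, forall t : R, P1 t}) (A2 : {ae mu, forall t : R, P2 t}) :=
    lebesgue_aeS2 (fun t => @conj (P1 t) (P2 t)) A1 A2.
  apply: lebesgue_aeS (both _ _ (both _ _ hg hy)
    (both _ _ (ae_integrable_conv ih ig) (ae_integrable_conv ih iy))).
  move=> t [[gt yt] [ihg ihy]] tT.
  transitivity (\int[mu]_r ((h (t - r) * g r)%:E - (h (t - r) * y r)%:E))%E.
    apply: eq_integral => r _; rewrite -EFinB -mulrBr; congr EFin.
    rewrite /d patchE; case: ifPn => //; rewrite notin_setE/= in_itv/= => /negP.
    rewrite negb_and -!ltNge => /orP[r0|Tr]; first by rewrite g0// y0// subrr.
    move: tT; rewrite in_itv/= => /andP[_ tT].
    by rewrite h0 ?mul0r// subr_lt0 (le_lt_trans tT).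
  rewrite (integralB _ ihg ihy)// gt// yt// subee//.
  by apply: integrable_fin_num => //; exact: integrableS iphi.
have mzero : measurable_fun setT (cst 0 : R -> R) by exact: measurable_cst.
have d0 x : x < 0 -> d x = 0.
  move=> x0; rewrite /d patchE memNset//= in_itv/= => /andP[]; by rewrite leNgt x0.
have := sonine_inversion ic ih id_ c0 h0 d0 P mzero (fun _ _ => erefl) hd.
move=> dint.
have : {ae mu, forall t, t \in `[0, T] -> d t = 0}.
  apply: integral_eq0_ae_eq0 => //; first exact: integrableS id_.
  apply: lebesgue_aeS dint => t /[apply].
  rewrite /Rintegral => <-; under eq_integral do rewrite mulr0.
  by rewrite integral0.
apply: lebesgue_aeS2 yE => t ye dt tT.
rewrite ye//; congr EFin; move: (dt tT).
by rewrite /d patchE mem_set//= => /eqP; rewrite subr_eq0 => /eqP.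
Qed.

End sonine_equivalence.

(** * Integrability forced by a finite double integral *)

Section local_integrability.
Context {R : realType}.
Notation mu := (@lebesgue_measure R).
Local Open Scope ereal_scope.

(** The inner integral of kappa(t) m(t - s) over t is bounded below by some q > 0, uniformly for s
    in [0, T - delta]; hence q times the integral of w is at most the finite double integral. *)
Lemma conv_local_integrability (T delta : R) (kappa m w : R -> R) :
  (0 < delta <= T)%R ->
  measurable_fun setT kappa -> measurable_fun setT m -> measurable_fun setT w ->
  (forall x, 0 <= kappa x)%R -> (forall x, 0 <= m x)%R -> (forall x, 0 <= w x)%R ->
  {ae mu, forall t, t \in `[0%R, T] -> (0 < kappa t)%R} ->
  0 < \int[mu]_(t in `[0%R, delta]) (m t)%:E ->
  \int[mu]_s \int[mu]_t (kappa t * m (t - s) * w s)%:E < +oo ->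
  \int[mu]_(s in `[0%R, (T - delta)%R]) (w s)%:E < +oo.
Proof.
move=> /andP[d0 dT] mk mm mw k0 m0 w0 kpos mpos fin.
have T0 : (0 < T)%R by exact: lt_le_trans dT.
(* Truncating m at 1 makes the mass lost over an exceptional set of t at most the measure of that
   set. *)
pose m1 t : R := Num.min (m t) 1%R.
have mm1 : measurable_fun setT m1 by exact: measurable_minr.
have m1ge0 t : (0 <= m1 t)%R by rewrite le_min m0 ler01.
have m1le1 t : (m1 t <= 1)%R by rewrite ge_min lexx orbT.
pose Id : set R := `[0%R, delta]%classic.
have mId : measurable Id by exact: measurable_itv.
have muId : mu Id = delta%:E by rewrite /Id lebesgue_measure_itv/= lte_fin d0 sube0.
pose mu0 := \int[mu]_(t in Id) (m1 t)%:E.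
have mu0_ge0 : 0 <= mu0 by apply: integral_ge0 => t _; rewrite lee_fin.
have mu0fin : mu0 \is a fin_num.
  rewrite ge0_fin_numE//; apply: (@le_lt_trans _ _ (\int[mu]_(t in Id) 1)).
    apply: ge0_le_integral => //.
    - by move=> t _; rewrite lee_fin.
    - by apply/measurable_EFinP; exact: measurable_funTS.
    - by move=> t _; rewrite lee_fin.
  by rewrite integral_cst// mul1e; have := ltry delta; rewrite -muId.
have mu0pos : 0 < mu0.
  rewrite lt_neqAle mu0_ge0 andbT eq_sym; apply: contraTneq mpos => mu00.
  suff -> : \int[mu]_(t in Id) (m t)%:E = 0 by rewrite ltxx.
  have : ae_eq mu Id (EFin \o m1) (cst 0).
    apply/ae_eq_integral_abs => //; first by apply/measurable_EFinP; exact: measurable_funTS.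
    by rewrite -[RHS]mu00; apply: eq_integral => t _ /=; rewrite ger0_norm.
  move=> m1eq; rewrite (@ae_eq_integral _ _ _ mu Id (cst 0))//.
  - exact: integral0.
  - by apply/measurable_EFinP; exact: measurable_funTS.
  apply: filterS m1eq => t m1t It; have := m1t It; rewrite /m1 /= => -[].
  by rewrite /Num.min; case: ifPn => [_ -> //|_ /eqP]; rewrite oner_eq0.
(* These sets decrease to a null set because kappa > 0 a.e.; some [B n] therefore has measure below
   half of [mu0]. *)
pose B n : set R := `[0%R, T]%classic `&` [set t | (kappa t < n.+1%:R^-1)%R].
have mB n : measurable (B n).
  apply: measurableI; first exact: measurable_itv.
  have -> : [set t | (kappa t < n.+1%:R^-1)%R] =
      setT `&` kappa @^-1` `]-oo, (n.+1%:R^-1)%R[%classic.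
    by apply/seteqP; split => t /=; rewrite in_itv/= => h; [split|case: h].
  by apply: mk => //; exact: measurable_itv.
have muB0 : mu (B 0%N) < +oo.
  apply: (@le_lt_trans _ _ (mu `[0%R, T]%classic)); last first.
    by rewrite lebesgue_measure_itv/= lte_fin T0 sube0 ltry.
  apply: le_measure; rewrite ?inE; [exact: mB|exact: measurable_itv|exact: subIsetl].
have Bnull : mu (\bigcap_n B n) = 0.
  have mcap : measurable (\bigcap_n B n) by exact: bigcapT_measurable.
  apply/negligibleP => //; apply: negligibleS kpos => t tB kt.
  have [tT _] := tB 0%N Logic.I.
  have kt0 : (0 < kappa t)%R by apply: kt.
  have [n /=] : exists n : nat, ((n.+1%:R : R)^-1 <= kappa t)%R.
    exists (Num.bound (kappa t)^-1); rewrite invf_ple ?posrE//.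
    rewrite ltW// (lt_le_trans (archi_boundP _))// ?invr_ge0 ?(ltW kt0)//.
    by rewrite ler_nat.
  by have [_ /=] := tB n Logic.I; rewrite ltNge => /negP.
have Bcvg : mu (B n) @[n --> \oo] --> 0.
  rewrite -Bnull; apply: nonincreasing_cvg_mu => //; first exact: bigcapT_measurable.
  move=> i j ij; apply/subsetPset => t [tT /= kj]; split => //=.
  by rewrite (lt_le_trans kj)// lef_pV2 ?posrE// ler_nat.
have e0 : (0 < fine mu0 / 2)%R by rewrite divr_gt0// fine_gt0// mu0pos -ge0_fin_numE.
have [n muBn] : exists n, mu (B n) < (fine mu0 / 2)%:E.
  have h : 0 < (fine mu0 / 2)%:E by rewrite lte_fin.
  by have [n _ nP] := Bcvg _ (open_ereal_lt' h); exists n; apply: nP => /=.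
pose beta : R := (n.+1%:R^-1)%R.
have beta0 : (0 < beta)%R by rewrite invr_gt0.
pose q : R := (beta * (fine mu0 / 2))%R.
have q0 : (0 < q)%R by rewrite mulr_gt0.
(* The window [s, s + delta] stays inside [0, T], and there kappa >= beta off [B n], so the integral
   is at least beta (mu0 - mu (B n)). *)
have Qge s : (0 <= s <= T - delta)%R -> q%:E <= \int[mu]_t (kappa t * m (t - s))%:E.
  move=> /andP[s0 sT].
  pose F x : \bar R := (beta * (m1 x * \1_Id x))%:E.
  have mF : measurable_fun setT F.
    apply/measurable_EFinP; apply: measurable_funM => //; apply: measurable_funM => //.
  have intF : \int[mu]_t F (t - s)%R = (beta * fine mu0)%:E.
    rewrite integral_shift// (integral_support (D := Id)); last first.
      by move=> x xI; rewrite /F indicE memNset// !mulr0.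
    rewrite EFinM fineK// -ge0_integralZl//; last 3 first.
    - by apply/measurable_EFinP; exact: measurable_funTS.
    - by move=> x _; rewrite lee_fin.
    - by rewrite lee_fin ltW.
    by apply: eq_integral => x xI; rewrite /F indicE xI mulr1 EFinM.
  have mkm : measurable_fun setT (fun t : R => (kappa t * m (t - s))%:E).
    apply/measurable_EFinP; apply: measurable_funM => //.
    by apply: measurableT_comp => //; exact: measurable_funB.
  have mBi : measurable_fun setT (fun t : R => (beta * \1_(B n) t)%:E).
    by apply/measurable_EFinP; exact: measurable_funM.
  have km0 t : 0 <= (kappa t * m (t - s))%:E by rewrite lee_fin mulr_ge0.
  have Bi0 t : 0 <= (beta * \1_(B n) t)%:E by rewrite lee_fin mulr_ge0// ltW.
  have ptw (t : R) : (beta * (m1 (t - s) * \1_Id (t - s)) <= kappa t * m (t - s) + beta * \1_(B n) t)%R.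
    rewrite !indicE.
    have [tsI|_] := boolP (_ \in Id); last by rewrite !mulr0 addr_ge0// mulr_ge0// ltW.
    have tT : t \in `[0%R, T].
      have : (0 <= t - s <= delta)%R by move: tsI; rewrite inE /Id /= in_itv.
      by rewrite in_itv/= => /andP[h1 h2]; apply/andP; split; lra.
    rewrite mulr1; have [kt|kt] := ltP (kappa t) beta.
      rewrite mem_set/=; last by split.
      rewrite mulr1 ler_wpDl ?mulr_ge0// ger_pMr//.
    apply: ler_wpDr; first by rewrite mulr_ge0// ltW.
    by apply: ler_pM => //; [exact: ltW|rewrite ge_min lexx].
  have le : (beta * fine mu0)%:E <= \int[mu]_t (kappa t * m (t - s))%:E + beta%:E * mu (B n).
    rewrite -intF.
    have -> : beta%:E * mu (B n) = \int[mu]_t (beta * \1_(B n) t)%:E.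
      under eq_integral do rewrite EFinM.
      have mBn : measurable_fun setT (fun t : R => (\1_(B n) t)%:E : \bar R).
        by apply/measurable_EFinP.
      have beta0' : 0 <= beta%:E by rewrite lee_fin ltW.
      rewrite (ge0_integralZl mu measurableT mBn _ beta0')//.
      by have := @integral_indic _ _ R mu setT measurableT (B n) (mB n); rewrite setIT => ->.
    rewrite -ge0_integralD//; apply: ge0_le_integral => //.
    - by move=> t _; rewrite lee_fin !mulr_ge0// ltW.
    - by apply: (measurableT_comp mF); exact: measurable_funB.
    - exact: emeasurable_funD.
    by move=> t _; rewrite -EFinD lee_fin; exact: ptw.
  have [|lty] := leP +oo (\int[mu]_t (kappa t * m (t - s))%:E).
    by apply: le_trans; rewrite leey.
  have Qfin : \int[mu]_t (kappa t * m (t - s))%:E \is a fin_num.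
    by rewrite ge0_fin_numE//; exact: integral_ge0.
  have Bfin : mu (B n) \is a fin_num by rewrite ge0_fin_numE// (lt_trans muBn) ?ltry.
  move: le muBn; rewrite -(fineK Qfin) -(fineK Bfin) -EFinM -EFinD !lee_fin lte_fin => le muBn.
  have : (beta * fine (mu (B n)) <= beta * (fine mu0 / 2))%R by rewrite ler_wpM2l// ltW.
  by rewrite /q; lra.
suff : q%:E * \int[mu]_(s in `[0%R, (T - delta)%R]) (w s)%:E < +oo.
  by apply: contraTT; rewrite -!leNgt !leye_eq => /eqP ->; rewrite gt0_muley ?lte_fin.
apply: le_lt_trans fin.
have mI : measurable (`[0%R, (T - delta)%R] : set (measurableTypeR R)) by exact: measurable_itv.
have mkmw : measurable_fun setT (fun z : R * R => (kappa z.2 * m (z.2 - z.1) * w z.1)%:E).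
  apply/measurable_EFinP; apply: measurable_funM; last exact: measurableT_comp.
  apply: measurable_funM; first exact: measurableT_comp.
  by apply: measurableT_comp => //; exact: measurable_funB.
have kmw0 z : 0 <= (kappa z.2 * m (z.2 - z.1) * w z.1)%:E by rewrite lee_fin !mulr_ge0.
have mint := @measurable_fun_fubini_tonelli_F _ _ _ _ R mu _ mkmw kmw0.
rewrite -ge0_integralZl//; last 3 first.
- by apply/measurable_EFinP; exact: measurable_funTS.
- by move=> x _; rewrite lee_fin.
- by rewrite lee_fin ltW.
apply: (@le_trans _ _ (\int[mu]_(s in `[0%R, (T - delta)%R])
    \int[mu]_t (kappa t * m (t - s) * w s)%:E)); last first.
  apply: ge0_subset_integral => //.
  by move=> s _; apply: integral_ge0 => t _; exact: (kmw0 (s, t)).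
apply: ge0_le_integral => //.
- by move=> s _; rewrite -EFinM lee_fin mulr_ge0// ltW.
- apply: emeasurable_funM => //; by apply/measurable_EFinP; exact: measurable_funTS.
- exact: measurable_funTS.
move=> s; rewrite /= in_itv/= => sI.
under eq_integral do rewrite EFinM.
rewrite ge0_integralZr//; last 3 first.
- apply/measurable_EFinP; apply: measurable_funM => //.
  by apply: measurableT_comp => //; exact: measurable_funB.
- by move=> t _; rewrite lee_fin mulr_ge0.
- by rewrite lee_fin.
by apply: lee_wpmul2r; [rewrite lee_fin|exact: Qge].
Qed.

End local_integrability.

(** * Domination of L_p functions by powers of integrable functions *)

Section Lp_domination.
Context {R : realType}.
Notation mu := (@lebesgue_measure R).

(** For finite p take x = |f|^p + 1 on [0, T] and M = 1; for p = +oo take x = 1 there and M the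
    essential supremum. The bound 1 <= x makes powers of x increase with the exponent. *)
Lemma Lp_on_powR_bound (T : R) (p : \bar R) (f : R -> R) : (1 <= p)%E ->
  Lp_on T p f -> exists (M : R) (x : R -> R),
  [/\ 0 <= M, mu.-integrable setT (EFin \o x),
    forall t, 0 <= x t, forall t, 0 <= t <= T -> 1 <= x t &
    {ae mu, forall t, t \in `[0, T] -> `|f t| <= M * x t `^ fine (p^-1)%E}].
Proof.
move=> p1 /andP[/[1!inE] mf /[1!inE] fin].
have mI : measurable (`[0, T] : set (measurableTypeR R)) by exact: measurable_itv.
have i1 : mu.-integrable setT (EFin \o (\1_(`[0, T]) : R -> R)).
  exact: integrable_indic_itv.
have ind1 t : 0 <= t <= T -> (\1_(`[0, T]) : R -> R) t = 1.
  by move=> tT; rewrite indicE mem_set//= in_itv.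
have ff t : 0 <= t <= T -> (f \_ `[0, T]) t = f t.
  by move=> tT; rewrite patchE mem_set//= in_itv.
case: p p1 fin => [r||] p1 fin; last by [].
  have r0 : 0 < r by apply: lt_le_trans ltr01 _; rewrite -lee_fin.
  pose fr (t : R) := `|(f \_ `[0, T]) t| `^ r.
  have mfr : measurable_fun setT fr.
    by apply: (measurableT_comp (measurable_powR r)); exact: measurableT_comp.
  have ifr : mu.-integrable setT (EFin \o fr).
    apply/integrableP; split; first exact/measurable_EFinP.
    have : (\int[mu]_x (`|((f \_ `[0, T]) x)%:E| `^ r) < +oo)%E.
      rewrite -(poweR_Lnorm mu (EFin \o (f \_ `[0, T])) (lt0r_neq0 r0)).
      exact: poweR_lty.
    apply: le_lt_trans; rewrite le_eqVlt; apply/orP; left; apply/eqP.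
    by apply: eq_integral => t _; rewrite /= ger0_norm// powR_ge0.
  exists 1, (fr \+ \1_(`[0, T])); split=> //.
  - by apply: eq_integrable (integrableD measurableT ifr i1) => //.
  - by move=> t; rewrite /= addr_ge0// powR_ge0.
  - by move=> t tT; rewrite /= ind1// lerDr powR_ge0.
  - apply: aeW => t; rewrite in_itv/= => tT; rewrite mul1r.
    have -> : fine (r%:E^-1)%E = r^-1 by rewrite inver gt_eqF.
    have -> : `|f t| = (`|f t| `^ r) `^ r^-1.
      by rewrite -powRrM mulfV ?lt0r_neq0// powRr1.
    apply: ge0_ler_powR; rewrite ?nnegrE ?powR_ge0 ?invr_ge0 ?(ltW r0)//.
      by rewrite addr_ge0// powR_ge0.
    by rewrite /fr ff// lerDl.
pose E := ess_sup mu (abse \o (EFin \o (f \_ `[0, T]))).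
have Efin : (E < +oo)%E.
  have mupos : (0 < mu setT)%E.
    have : (mu `[0%R, 1%R]%classic <= mu setT)%E by apply: le_measure; rewrite ?inE.
    by apply: lt_le_trans; rewrite lebesgue_measure_itv/= lte_fin ltr01 sube0 lte_fin.
  by move: fin; rewrite /= /finite_norm unlock mupos.
exists (Num.max 0 (fine E)), \1_(`[0, T]); split => //.
- by rewrite le_max lexx.
- by move=> t tT; rewrite ind1.
- have := ess_sup_ge mu (abse \o (EFin \o (f \_ `[0, T]))).
  apply: lebesgue_aeS => t; rewrite -/E => + tT; move: tT; rewrite in_itv/= => tT.
  rewrite powRr0 mulr1 ff//.
  by case: (E) Efin => // e _; rewrite lee_fin le_max => ->; rewrite orbT.
Qed.

(* The exponents lie below the convex hull of (1,1,0), (1,0,1) and (0,1,1). *)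
Lemma powR_mul3_le (x y z al be ga : R) : 1 <= x -> 1 <= y -> 1 <= z ->
  0 <= al <= 1 -> 0 <= be <= 1 -> 0 <= ga <= 1 -> al + be + ga <= 2 ->
  x `^ al * y `^ be * z `^ ga <= x * y + y * z + x * z.
Proof.
move=> x1 y1 z1 al1 be1 ga1 abg.
have [x0 [y0 z0]] : 0 < x /\ 0 < y /\ 0 < z by split; [|split]; apply: lt_le_trans ltr01 _.
have [X0 [Y0 Z0]] : 0 <= ln x /\ 0 <= ln y /\ 0 <= ln z by split; [|split]; exact: ln_ge0.
rewrite /powR !gt_eqF// -!expRD.
set X := ln x in X0 *; set Y := ln y in Y0 *; set Z := ln z in Z0 *.
have pxy : x * y = expR (X + Y) by rewrite expRD !lnK.
have pyz : y * z = expR (Y + Z) by rewrite expRD !lnK.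
have pxz : x * z = expR (X + Z) by rewrite expRD !lnK.
rewrite pxy pyz pxz.
(* With W the smallest of the three logarithms, U + V minus the left side is (1 - a)(U - W) + (1 -
   b)(V - W) + (2 - a - b - g) W. *)
have key (a b g U V W : R) : 0 <= a <= 1 -> 0 <= b <= 1 -> a + b + g <= 2 ->
    0 <= W -> W <= U -> W <= V -> a * U + b * V + g * W <= U + V.
  move=> /andP[_ a1] /andP[_ b1] abg' W0 WU WV.
  have h1 : 0 <= (1 - a) * (U - W) by rewrite mulr_ge0// subr_ge0.
  have h2 : 0 <= (1 - b) * (V - W) by rewrite mulr_ge0// subr_ge0.
  have h3 : 0 <= (2 - (a + b + g)) * W by rewrite mulr_ge0// subr_ge0.
  lra.
have e1 := expR_ge0 (X + Y); have e2 := expR_ge0 (Y + Z); have e3 := expR_ge0 (X + Z).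
have [ZX|XZ] := leP Z X; have [ZY|YZ] := leP Z Y.
- have : expR (al * X + be * Y + ga * Z) <= expR (X + Y) by rewrite ler_expR; exact: key.
  by lra.
- have : expR (al * X + be * Y + ga * Z) <= expR (X + Z).
    by rewrite ler_expR addrAC; apply: key => //; lra.
  by lra.
- have : expR (al * X + be * Y + ga * Z) <= expR (Y + Z).
    by rewrite ler_expR -addrA addrC; apply: key => //; lra.
  by lra.
- have [XY|YX] := leP X Y.
    have : expR (al * X + be * Y + ga * Z) <= expR (Y + Z).
      by rewrite ler_expR -addrA addrC; apply: key => //; lra.
    by lra.
  have : expR (al * X + be * Y + ga * Z) <= expR (X + Z).
    by rewrite ler_expR addrAC; apply: key => //; lra.
  by lra.
Qed.

End Lp_domination.

(** * Absolute convergence for square-integrable unknowns *)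

Section young.
Context {R : realType}.
Notation mu := (@lebesgue_measure R).

Lemma lebesgue_ae_shift (P : R -> Prop) (s : R) :
  {ae mu, forall v, P v} -> {ae mu, forall v, P (v - s)}.
Proof.
move=> [N [mN N0 sN]].
have mrefl (t : R) (A : set R) : measurable A -> measurable [set v | A (t - v)].
  move=> mA; rewrite -[X in measurable X]setTI.
  have mt : measurable_fun setT (fun v : R => t - v) by exact: measurable_funB.
  exact: mt.
exists [set v | N (0 - (s - v))]; split.
- exact: (mrefl s [set v | N (0 - v)] (mrefl 0 N mN)).
- rewrite -[RHS]N0; transitivity (mu [set v | N (0 - v)]).
    exact: (lebesgue_measure_reflect s (mrefl 0 N mN)).
  exact: (lebesgue_measure_reflect 0 mN).
- by move=> v vP; apply: sN => /= Pv; apply: vP => /=; move: Pv; congr P; ring.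
Qed.

Lemma inve_ge1 (p : \bar R) : (1 <= p)%E ->
  p^-1%E = (fine (p^-1)%E)%:E /\ 0 <= fine (p^-1)%E <= 1.
Proof.
case: p => [t| |//]; last by rewrite invey lexx ler01.
rewrite lee_fin => t1; have t0 : 0 < t by apply: lt_le_trans ltr01 _.
by rewrite inver gt_eqF//= invr_ge0 (ltW t0) invf_le1.
Qed.

Lemma inve_ge2 (p : \bar R) : (2%:E <= p)%E -> fine (p^-1)%E <= 1 / 2.
Proof.
case: p => [t| |//]; last by rewrite invey divr_ge0.
rewrite lee_fin => t2; have t0 : 0 < t by apply: lt_le_trans t2.
by rewrite inver gt_eqF//= div1r lef_pV2// posrE.
Qed.

(** The factors a and f share the variable s, and f contributes the exponent 1/2. So s, v and v - s
    carry exponents 1/p + 1/2, 1/q and 1/r, each at most 1 (here p >= 2 enters) and with sum at most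
    2 (here the bound 3/2 enters). [powR_mul3_le] then bounds the integrand by pairwise products,
    each integrable on the plane. *)
Lemma young_kernel_finite (T : R) (p q r : \bar R) (a f b c : R -> R) :
  (2%:E <= p)%E -> (1 <= q)%E -> (1 <= r)%E ->
  (p^-1 + q^-1 + r^-1 <= (3 / 2)%:E)%E ->
  Lp_on T p a -> Lp_on T 2%:E f -> Lp_on T q b -> Lp_on T r c ->
  (\int[mu]_s \int[mu]_v
     `| (a \_ `[0%R, T] s * f \_ `[0%R, T] s * b \_ `[0%R, T] v * c \_ `[0%R, T] (v - s))%:E | < +oo)%E.
Proof.
move=> p2 q1 r1 pqr La Lf Lb Lc.
have p1 : (1 <= p)%E by apply: le_trans p2; rewrite lee_fin ler1n.
have le12 : (1 <= 2%:E :> \bar R)%E by rewrite lee_fin ler1n.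
have [Ma [x [Ma0 ix x0 x1 xa]]] := Lp_on_powR_bound p1 La.
have [Mf [w [Mf0 iw w0 w1 wf]]] := Lp_on_powR_bound le12 Lf.
have [Mb [y [Mb0 iy y0 y1 yb]]] := Lp_on_powR_bound q1 Lb.
have [Mc [z [Mc0 iz z0 z1 zc]]] := Lp_on_powR_bound r1 Lc.
have [pE p01] := inve_ge1 p1; have [qE q01] := inve_ge1 q1; have [rE r01] := inve_ge1 r1.
set al := fine (p^-1)%E in pE p01 xa; set be := fine (q^-1)%E in qE q01 yb.
set ga := fine (r^-1)%E in rE r01 zc.
have al2 : al <= 1 / 2 by exact: inve_ge2.
have sum : al + be + ga <= 3 / 2 by rewrite -lee_fin !EFinD -pE -qE -rE.
have e2 : fine ((2%:E : \bar R)^-1)%E = 1 / 2 by rewrite inver gt_eqF//= div1r.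
rewrite e2 in wf.
clear pE qE rE p1 le12 e2 p2 q1 r1 pqr.
(* A common majorant of the functions dominating a and f, so that their powers merge into one power
   of [X]. *)
pose X s := x s + w s.
have iX : mu.-integrable setT (EFin \o X).
  by apply: eq_integrable (integrableD measurableT ix iw) => //.
have X0 s : 0 <= X s by rewrite addr_ge0.
have iz' : mu.-integrable setT (EFin \o (fun u => z (- u))).
  have /integrableP[mz jz] := iz; apply/integrableP; split.
    by apply: (measurableT_comp mz); exact: measurable_funN.
  apply: le_lt_trans jz; rewrite le_eqVlt; apply/orP; left; apply/eqP.
  rewrite -[RHS](integral_reflect 0); last exact: measurableT_comp.
  by apply: eq_integral => u _; rewrite /= sub0r.
have mEFin (g : R -> R) : mu.-integrable setT (EFin \o g) -> measurable_fun setT g.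
  by move=> i; apply/measurable_EFinP; exact: measurable_int i.
have mX := mEFin _ iX; have my := mEFin _ iy; have mz := mEFin _ iz.
have mzB : measurable_fun setT (fun sv : R * R => z (sv.2 - sv.1)).
  by apply: measurableT_comp => //; exact: measurable_funB.
have mX1 : measurable_fun setT (fun sv : R * R => X sv.1) by exact: measurableT_comp.
have my2 : measurable_fun setT (fun sv : R * R => y sv.2) by exact: measurableT_comp.
have i1 : (mu \x mu)%E.-integrable setT (fun sv : R * R => (X sv.1 * y sv.2)%:E).
  apply/integrable12ltyP; first by apply/measurable_EFinP; exact: measurable_funM.
  have /integrableP[_ jX] := iX; have /integrableP[_ jy] := iy.
  apply: (@le_lt_trans _ _ ((\int[mu]_s `|(EFin \o X) s|) * (\int[mu]_v `|(EFin \o y) v|))%E).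
    rewrite -ge0_integralZr//; last 2 first.
    - by apply: measurableT_comp => //; exact/measurable_EFinP.
    - exact: integral_ge0.
    rewrite le_eqVlt; apply/orP; left; apply/eqP; apply: eq_integral => s _.
    rewrite -ge0_integralZl//; last by apply: measurableT_comp => //; exact/measurable_EFinP.
    by apply: eq_integral => v _; rewrite /= normrM EFinM.
  apply: lte_mul_pinfty => //; first exact: integral_ge0.
  by rewrite ge0_fin_numE//; exact: integral_ge0.
have i2 : (mu \x mu)%E.-integrable setT (fun sv : R * R => (z (sv.2 - sv.1) * y sv.2)%:E).
  apply: eq_integrable (integrable_conv_kernel iz' iy) => // sv _ /=.
  by rewrite opprB.
have i3 : (mu \x mu)%E.-integrable setT (fun sv : R * R => (z (sv.2 - sv.1) * X sv.1)%:E).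
  have mk : measurable_fun setT (fun sv : R * R => (z (sv.2 - sv.1) * X sv.1)%:E).
    by apply/measurable_EFinP; exact: measurable_funM.
  have ik := integrable_conv_kernel iz iX.
  have mk2 : measurable_fun setT (fun sv : R * R => (z (sv.1 - sv.2) * X sv.2)%:E).
    apply/measurable_EFinP; apply: measurable_funM; last exact: measurableT_comp.
    by apply: measurableT_comp => //; exact: measurable_funB.
  by apply/integrable21ltyP => //; exact: ((integrable12ltyP mu mu mk2).1 ik).
pose M := Ma * Mf * Mb * Mc.
have M0 : 0 <= M by rewrite !mulr_ge0.
pose G (sv : R * R) := M * (X sv.1 * y sv.2 + z (sv.2 - sv.1) * y sv.2 + z (sv.2 - sv.1) * X sv.1).
have G0 sv : 0 <= G sv by rewrite mulr_ge0// !addr_ge0// mulr_ge0.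
have iG : (mu \x mu)%E.-integrable setT (EFin \o G).
  apply: eq_integrable (integrableZl measurableT M (integrableD measurableT (integrableD measurableT i1 i2) i3)) => //.
have /integrableP[mG _] := iG.
have a0E (g : R -> R) t : g \_ `[0, T] t = if (0 <= t <= T) then g t else 0.
  by rewrite patchE mem_setE in_itv.
have bound s v : (s \in `[0, T] -> `|a s| <= Ma * x s `^ al) ->
    (s \in `[0, T] -> `|f s| <= Mf * w s `^ (1 / 2)) ->
    (v \in `[0, T] -> `|b v| <= Mb * y v `^ be) ->
    ((v - s) \in `[0, T] -> `|c (v - s)| <= Mc * z (v - s) `^ ga) ->
    `|a \_ `[0, T] s * f \_ `[0, T] s * b \_ `[0, T] v * c \_ `[0, T] (v - s)| <= G (s, v).
  rewrite !in_itv !a0E /=.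
  case: ifPn => sT; last by rewrite !mul0r normr0.
  case: ifPn => vT; last by rewrite mulr0 mul0r normr0.
  case: ifPn => vsT; last by rewrite mulr0 normr0.
  move=> /(_ isT) h1 /(_ isT) h2 /(_ isT) h3 /(_ isT) h4.
  rewrite !normrM; apply: (@le_trans _ _
    (Ma * x s `^ al * (Mf * w s `^ (1 / 2)) * (Mb * y v `^ be) * (Mc * z (v - s) `^ ga))).
    by rewrite !ler_pM ?mulr_ge0 ?powR_ge0.
  have -> : Ma * x s `^ al * (Mf * w s `^ (1 / 2)) * (Mb * y v `^ be) * (Mc * z (v - s) `^ ga)
     = M * (x s `^ al * w s `^ (1 / 2) * y v `^ be * z (v - s) `^ ga) by rewrite /M; ring.
  rewrite /G /= ler_wpM2l//.
  have xs1 := x1 _ sT; have ws1 := w1 _ sT; have yv1 := y1 _ vT; have zv1 := z1 _ vsT.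
  have Xs1 : 1 <= X s by rewrite /X; lra.
  have hX : x s `^ al * w s `^ (1 / 2) <= X s `^ (al + 1 / 2).
    rewrite powRD; last by apply/implyP => _; rewrite gt_eqF//; apply: lt_le_trans ltr01 _.
    case/andP: p01 => al0 _.
    by apply: ler_pM; rewrite ?powR_ge0//; apply: ge0_ler_powR; rewrite ?nnegrE// /X; lra.
  have := @powR_mul3_le _ (X s) (y v) (z (v - s)) (al + 1 / 2) be ga Xs1 yv1 zv1.
  case/andP: p01 => al0 al1.
  have -> : 0 <= al + 1 / 2 <= 1 by apply/andP; split; lra.
  move=> /(_ isT q01 r01) h.
  apply: le_trans (_ : X s `^ (al + 1 / 2) * y v `^ be * z (v - s) `^ ga <= _).
    by rewrite !ler_wpM2r ?powR_ge0.
  apply: (le_trans (h _)); first by lra.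
  by rewrite (mulrC (z _) (y v)) (mulrC (z _) (X s)).
have := (integrable12ltyP mu mu mG).1 iG; apply: le_lt_trans.
have mK : measurable_fun setT (fun sv : R * R =>
    (a \_ `[0, T] sv.1 * f \_ `[0, T] sv.1 * b \_ `[0, T] sv.2 * c \_ `[0, T] (sv.2 - sv.1))%:E).
  have mL e (g : R -> R) : Lp_on T e g -> measurable_fun setT (g \_ `[0, T]).
    by move=> /andP[/[1!inE]].
  have m1 (g : R -> R) : measurable_fun setT g -> measurable_fun setT (fun sv : R * R => g sv.1).
    by move=> mg; exact: measurableT_comp.
  have m2 (g : R -> R) : measurable_fun setT g -> measurable_fun setT (fun sv : R * R => g sv.2).
    by move=> mg; exact: measurableT_comp.
  apply/measurable_EFinP; apply: measurable_funM; last first.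
    by apply: (measurableT_comp (mL _ _ Lc)); exact: measurable_funB.
  apply: measurable_funM; last exact: m2 (mL _ _ Lb).
  by apply: measurable_funM; [exact: m1 (mL _ _ La)|exact: m1 (mL _ _ Lf)].
have mKa : measurable_fun setT (fun sv : R * R =>
    `|(a \_ `[0%R, T] sv.1 * f \_ `[0%R, T] sv.1 * b \_ `[0%R, T] sv.2 * c \_ `[0%R, T] (sv.2 - sv.1))%:E|)%E.
  exact: measurableT_comp.
have mGa : measurable_fun setT (fun sv : R * R => `|(EFin \o G) sv|)%E by exact: measurableT_comp.
have mpair (s : R) : measurable_fun setT (fun v : R => (s, v)).
  by apply/measurable_fun_pairP; split; [exact: measurable_cst|exact: measurable_id].
apply: ae_ge0_le_integral => //.
- by move=> s _; apply: integral_ge0.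
- exact: (@measurable_fun_fubini_tonelli_F _ _ _ _ R mu _ mKa).
- by move=> s _; apply: integral_ge0.
- exact: (@measurable_fun_fubini_tonelli_F _ _ _ _ R mu _ mGa).
apply: lebesgue_aeS2 xa wf => s xs ws _.
apply: ae_ge0_le_integral => //.
- exact: (measurableT_comp (f := fun sv : R * R => `|_|%E) mKa (mpair s)).
- exact: (measurableT_comp (f := fun sv : R * R => `|_|%E) mGa (mpair s)).
apply: lebesgue_aeS2 yb (lebesgue_ae_shift s zc) => v yv zv _.
by rewrite lee_fin (le_trans (bound _ _ xs ws yv zv))// ler_norm.
Qed.

End young.

(** * The operator as the primitive of b times c * (a f) *)

Section operator.
Context {R : realType}.
Notation mu := (@lebesgue_measure R).
Variables (T : R) (a b c f : R -> R).

Let phi0 := (a \* f) \_ `[0, T].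
Let b0 := b \_ `[0, T].
Let c0 := c \_ `[0, T].
Let K (z : R * R) : \bar R := (phi0 z.1 * b0 z.2 * c0 (z.2 - z.1))%:E.

Let restrictE (g : R -> R) t : (g \_ `[0, T]) t = if 0 <= t <= T then g t else 0.
Proof. by rewrite patchE mem_setE in_itv. Qed.

Lemma Lp_on_measurable (p : \bar R) (g : R -> R) : Lp_on T p g ->
  measurable_fun setT (g \_ `[0, T]).
Proof. by move=> /andP[/[1!inE]]. Qed.

(** Both forms of admissibility give integrability on the whole plane: the truncated kernel vanishes
    off the triangle 0 <= s <= v <= T. *)
Lemma Kop_kernel_integrable (p q r : \bar R) :
  (2%:E <= p)%E -> (1 <= q)%E -> (1 <= r)%E ->
  (p^-1 + q^-1 + r^-1 <= (3 / 2)%:E)%E ->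
  Lp_on T p a -> Lp_on T q b -> Lp_on T r c ->
  Kop_admissible T a b c f ->
  measurable_fun setT phi0 /\ (mu \x mu)%E.-integrable setT K.
Proof.
move=> p2 q1 r1 pqr La Lb Lc [mf adm].
have mb := Lp_on_measurable Lb; have mc := Lp_on_measurable Lc.
have mI : measurable (`[0, T] : set R) by exact: measurable_itv.
have mf0 : measurable_fun setT (f \_ `[0, T]) by apply/(measurable_restrictT _ _).1.
have phiE s : phi0 s = a \_ `[0, T] s * f \_ `[0, T] s.
  by rewrite /phi0 !restrictE; case: ifP => //; rewrite mul0r.
have mphi : measurable_fun setT phi0.
  rewrite (_ : phi0 = a \_ `[0, T] \* f \_ `[0, T]); last by apply/funext => s; rewrite phiE.
  by apply: measurable_funM => //; exact: Lp_on_measurable La.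
split => //.
have mK : measurable_fun setT K.
  apply/measurable_EFinP; apply: measurable_funM; last first.
    by apply: (measurableT_comp mc); exact: measurable_funB.
  by apply: measurable_funM; [exact: (measurableT_comp mphi)|exact: (measurableT_comp mb)].
case: adm => [Lf|tri].
  apply/integrable12ltyP => //.
  have := young_kernel_finite p2 q1 r1 pqr La Lf Lb Lc.
  apply: le_lt_trans; rewrite le_eqVlt; apply/orP; left; apply/eqP.
  apply: eq_integral => s _; apply: eq_integral => v _.
  by rewrite /K/= phiE.
set D := (X in _.-integrable X _) in tri.
have mD : measurable D.
  have -> : D = [set z | 0 <= z.1] `&` ([set z | z.1 <= z.2] `&` [set z | z.2 <= T]).
    by apply/seteqP; split => z; [case=> ? ? ?|case=> ? [? ?]].
  have m12 : measurable_fun setT (fun z : R * R => z.2 - z.1) by exact: measurable_funB.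
  have m1 : measurable_fun setT (fun z : R * R => z.1) by exact: measurable_fst.
  have m2 : measurable_fun setT (fun z : R * R => z.2) by exact: measurable_snd.
  have -> : [set z : R * R | 0 <= z.1] = setT `&` (fun z : R * R => z.1) @^-1` `[0, +oo[%classic.
    by apply/seteqP; split => z /=; rewrite in_itv/= andbT => // -[].
  have -> : [set z : R * R | z.1 <= z.2] =
      setT `&` (fun z : R * R => z.2 - z.1) @^-1` `[0, +oo[%classic.
    by apply/seteqP; split => z /=; rewrite in_itv/= andbT subr_ge0 => // -[].
  have -> : [set z : R * R | z.2 <= T] = setT `&` (fun z : R * R => z.2) @^-1` `]-oo, T]%classic.
    by apply/seteqP; split => z /=; rewrite in_itv/= => // -[].
  by apply: measurableI; [|apply: measurableI]; [apply: m1|apply: m12|apply: m2] => //; exact: measurable_itv.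
move: tri; rewrite integrable_mkcond//; apply: eq_integrable => // -[s v] _.
rewrite patchE /K /= /phi0 /b0 /c0 !restrictE.
case: ifPn => [|]; rewrite ?inE ?notin_setE /D/=.
  move=> [s0 sv vT]; rewrite s0 vT (le_trans s0 sv) (le_trans sv vT) subr_ge0 sv/=.
  have -> : v - s <= T by lra.
  by congr EFin; ring.
move=> nD; case: ifPn => [/andP[s0 sT]|]; last by rewrite !mul0r.
case: ifPn => [/andP[v0 vT]|]; last by rewrite mulr0 mul0r.
case: ifPn => [/andP[vs0 vsT]|]; last by rewrite mulr0.
by exfalso; apply: nD; split => //; rewrite -subr_ge0.
Qed.

Hypotheses (mphi : measurable_fun setT phi0) (mb : measurable_fun setT b0)
  (mc : measurable_fun setT c0) (iK : (mu \x mu)%E.-integrable setT K).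

Definition volterra_density (v : R) : R := fine (\int[mu]_s K (s, v))%E.

Lemma integrable_volterra_density : mu.-integrable setT (EFin \o volterra_density).
Proof.
have mG := measurable_fubini_G iK.
have /integrableP[mK _] := iK.
have jK := (integrable21ltyP mu mu mK).1 iK.
have m : measurable_fun setT (EFin \o volterra_density).
  by apply/measurable_EFinP; apply: (measurableT_comp _ mG) => //; exact: fine_measurable.
apply/integrableP; split => //; apply: le_lt_trans jK; apply: ge0_le_integral => //.
- exact: measurableT_comp.
- have mKa : measurable_fun setT (abse \o K) by exact: measurableT_comp.
  exact: (@measurable_fun_fubini_tonelli_G _ _ _ _ R mu _ mKa (fun=> abse_ge0 _)).
move=> v _; apply: (@le_trans _ _ `|\int[mu]_s K (s, v)|%E).
  by rewrite /volterra_density /=; case: (integral _ _ _) => //=; rewrite normr0 leey.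
apply: le_abse_integral => //; apply: (measurableT_comp mK).
by apply/measurable_fun_pairP; split; [exact: measurable_id|exact: measurable_cst].
Qed.

(** Fubini on the triangle 0 <= s <= v <= t, encoded by multiplying the plane kernel with the
    indicator of [0, t] in v. *)
Lemma Kop_integral (t : R) : 0 <= t <= T ->
  Kop a b c f t = \int[mu]_(v in `[0, t]) volterra_density v.
Proof.
move=> /andP[t0 tT].
pose ind : R -> R := \1_(`[0, t]).
have mind : measurable_fun setT ind by exact: measurable_indic.
have indE v : ind v = if 0 <= v <= t then 1 else 0.
  by rewrite /ind indicE mem_setE in_itv; case: ifP.
pose k (z : R * R) : R := b0 z.2 * c0 (z.2 - z.1) * ind z.2.
have mk : measurable_fun setT k.
  apply: measurable_funM; last exact: (measurableT_comp mind).
  apply: measurable_funM; first exact: (measurableT_comp mb).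
  by apply: (measurableT_comp mc); exact: measurable_funB.
pose Phi (s : R) : \bar R := (\int[mu]_v (k (s, v))%:E)%E.
(* [k] is not known to be integrable, so measurability comes from Tonelli on its positive and
   negative parts. *)
have mPhi : measurable_fun setT Phi.
  have mkE : measurable_fun setT (EFin \o k) by exact/measurable_EFinP.
  have -> : Phi = (fun s => \int[mu]_v ((EFin \o k)^\+ (s, v)) - \int[mu]_v ((EFin \o k)^\- (s, v)))%E.
    apply/funext => s; rewrite /Phi integralE; congr (_ - _)%E;
      by apply: eq_integral => v _; rewrite ?funeposE ?funenegE.
  apply: emeasurable_funB.
    by apply: (@measurable_fun_fubini_tonelli_F _ _ _ _ R mu) => //; exact: measurable_funepos.
  by apply: (@measurable_fun_fubini_tonelli_F _ _ _ _ R mu) => //; exact: measurable_funeneg.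
pose W (s : R) : R := phi0 s * fine (Phi s).
have mW : measurable_fun setT W.
  by apply: measurable_funM => //; apply: (measurableT_comp _ mPhi); exact: fine_measurable.
pose Kt (z : R * R) : \bar R := (phi0 z.1 * k z)%:E.
have KtE z : Kt z = (K z * (ind z.2)%:E)%E.
  by rewrite /Kt /K /k -EFinM; congr EFin; ring.
have iKt : (mu \x mu)%E.-integrable setT Kt.
  apply: (le_integrable measurableT _ _ iK).
    by apply/measurable_EFinP; apply: measurable_funM => //; exact: (measurableT_comp mphi).
  move=> z _; rewrite KtE indE; case: ifP => _; first by rewrite mule1.
  by rewrite mule0 abse0.
have FUB := Fubini iKt.
have left_ : (\int[mu]_s \int[mu]_v Kt (s, v) = \int[mu]_s (W s)%:E)%E.
  apply: ae_eq_integral => //.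
  - exact: (measurable_fubini_F iKt).
  - exact/measurable_EFinP.
  apply: lebesgue_aeS (ae_integrable1 iKt) => s is_ _.
  (* Where a f vanishes, the inner integral may diverge, but its default value is multiplied by 0;
     elsewhere dividing by [phi0 s] gives its convergence. *)
  have [p0|p0] := eqVneq (phi0 s) 0.
    by rewrite /W p0 mul0r; apply: integral0_eq => v _; rewrite /Kt/= p0 mul0r.
  have ik : mu.-integrable setT (fun v => (k (s, v))%:E).
    apply: eq_integrable (integrableZl measurableT (phi0 s)^-1 is_) => // v _.
    by rewrite /Kt/= -EFinM mulrA mulVf// mul1r.
  rewrite /W EFinM fineK; last by exact: integrable_fin_num.
  by rewrite /Phi -integralZl//; apply: eq_integral => v _; rewrite /Kt/= EFinM.
have right_ : (\int[mu]_v \int[mu]_s Kt (s, v) = \int[mu]_(v in `[0%R, t]) (volterra_density v)%:E)%E.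
  have mI : measurable (`[0, t] : set R) by exact: measurable_itv.
  rewrite [RHS]integral_mkcond; apply: ae_eq_integral => //.
  - exact: (measurable_fubini_G iKt).
  - apply/(measurable_restrictT _ _).1 => //; apply: measurable_funTS.
    exact: measurable_int integrable_volterra_density.
  apply: lebesgue_aeS (ae_integrable2 iK) => v iv _.
  rewrite patchE mem_setE in_itv/=; case: ifPn => vt.
    rewrite /volterra_density fineK; last exact: integrable_fin_num.
    by apply: eq_integral => s _; rewrite KtE indE/= vt mule1.
  by apply: integral0_eq => s _; rewrite KtE indE/= (negbTE vt) mule0.
rewrite /Kop /Rintegral -right_ -FUB left_ (integral_support (D := `[0, t])); last first.
  move=> s /=; rewrite in_itv/= => /negP; rewrite /W /phi0 restrictE.
  case: ifPn => [/andP[s0 sT]|_ _]; last by rewrite mul0r.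
  rewrite s0/= -ltNge => ts; rewrite /Phi integral0_eq ?mulr0// => v _.
  rewrite /k indE/=; case: ifPn => [/andP[_ vt]|]; last by rewrite mulr0.
  rewrite /c0 restrictE ifF ?mulr0 ?mul0r//.
  by apply/negbTE; rewrite negb_and -!ltNge subr_lt0 (le_lt_trans vt).
congr fine; apply: eq_integral => s; rewrite inE/= in_itv/= => /andP[s0 st].
congr EFin; rewrite /W /phi0 restrictE s0 (le_trans st tT)/= /Phi.
rewrite (integral_support (D := `[s, t])); last first.
  move=> v /=; rewrite in_itv/= => /negP vst; rewrite /k /= indE.
  case: ifPn => [/andP[v0 vt]|]; last by rewrite mulr0.
  rewrite /c0 restrictE ifF ?mulr0 ?mul0r//.
  apply/negbTE; rewrite negb_and -!ltNge subr_lt0.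
  by move: vst; rewrite vt andbT -ltNge => ->.
rewrite mulrAC; congr (_ * _); congr fine.
apply: eq_integral => v; rewrite inE/= in_itv/= => /andP[sv vt].
rewrite /k /= indE (le_trans s0 sv) vt/= mulr1 /b0 /c0 !restrictE.
rewrite (le_trans s0 sv) (le_trans vt tT) subr_ge0 sv/=.
by have -> : v - s <= T by lra.
Qed.

(** Dividing an integrable slice of the kernel by b v, which is nonzero a.e., gives the convergence
    of c * (a f) at v. *)
Lemma volterra_density_conv :
  {ae mu, forall v, v \in `[0, T] -> 0 < b v} ->
  {ae mu, forall v, v \in `[0, T] ->
    volterra_density v = b v * fine (\int[mu]_s (c0 (v - s) * phi0 s)%:E)%E /\
    mu.-integrable setT (fun s => (c0 (v - s) * phi0 s)%:E)}.
Proof.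
move=> bpos; apply: lebesgue_aeS2 bpos (ae_integrable2 iK) => v bv iv vI.
have b0v : b0 v = b v by rewrite /b0 patchE mem_setE vI.
have bv0 : b v != 0 by rewrite gt_eqF// bv.
have ic : mu.-integrable setT (fun s => (c0 (v - s) * phi0 s)%:E).
  apply: eq_integrable (integrableZl measurableT (b v)^-1 iv) => // s _.
  by rewrite /K/= -EFinM b0v; congr EFin; field.
split=> //; rewrite /volterra_density; transitivity (fine ((b v)%:E * \int[mu]_s (c0 (v - s) * phi0 s)%:E)%E).
  congr fine; rewrite -integralZl//; apply: eq_integral => s _.
  by rewrite /K/= b0v -EFinM; congr EFin; ring.
by rewrite fineM//; exact: integrable_fin_num.
Qed.

End operator.

(** * Auxiliary facts on the data of the equation *)

Section sonine_data.
Context {R : realType}.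
Notation mu := (@lebesgue_measure R).

(** The inverse is g times the square of |g|^(-1), and real powers are measurable; at zeros of g
    both sides are 0. *)
Lemma measurable_fun_inv (g : R -> R) : measurable_fun setT g ->
  measurable_fun setT (fun x : R => (g x)^-1).
Proof.
move=> mg.
have -> : (fun x => (g x)^-1) = (fun x : R => g x * (`|g x| `^ (-1)) ^+ 2).
  apply/funext => x; have [->|gx] := eqVneq (g x) 0; first by rewrite invr0 mul0r.
  rewrite powR_inv1// exprVn real_normK ?num_real// expr2 invfM mulrA mulfV// mul1r//.
apply: measurable_funM => //; apply: measurable_funX.
by apply: (measurableT_comp (measurable_powR (-1))); exact: measurableT_comp.
Qed.

(** Here |f| <= M x^(1/p) <= M x, since x >= 1 on [0, T]. *)
Lemma Lp_on_integrable (T : R) (p : \bar R) (f : R -> R) : (1 <= p)%E ->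
  Lp_on T p f -> mu.-integrable setT (EFin \o f \_ `[0, T]).
Proof.
move=> p1 Lf; have mf := Lp_on_measurable Lf.
have [M [x [M0 ix x0 x1 fx]]] := Lp_on_powR_bound p1 Lf.
have [_ p01] := inve_ge1 p1.
have /integrableP[mMx jMx] : mu.-integrable setT (EFin \o (fun t => M * x t)).
  by apply: eq_integrable (integrableZl measurableT M ix).
apply/integrableP; split; first exact/measurable_EFinP.
apply: le_lt_trans jMx; apply: ae_ge0_le_integral => //.
- by apply: measurableT_comp => //; exact/measurable_EFinP.
- exact: measurableT_comp.
apply: lebesgue_aeS fx => t ft _; rewrite lee_fin (ger0_norm (mulr_ge0 M0 (x0 t))).
rewrite patchE mem_setE; case: ifPn => [tT|_]; last by rewrite normr0 mulr_ge0.
apply: (le_trans (ft tT)); rewrite ler_wpM2l//.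
have x1t : 1 <= x t by apply: x1; rewrite in_itv in tT.
rewrite -[leRHS]powRr1//; apply: ler_powR => //.
by case/andP: p01.
Qed.

Lemma volterra_conv_eq (k k' g g' : R -> R) (t : R) :
  (forall s, 0 <= s <= t -> k s = k' s) -> (forall s, 0 <= s <= t -> g s = g' s) ->
  (volterra_conv_defined k g t -> volterra_conv_defined k' g' t) /\
  volterra_conv k g t = volterra_conv k' g' t.
Proof.
move=> kk gg; have E s : 0 <= s <= t -> k (t - s) * g s = k' (t - s) * g' s.
  by move=> /andP[s0 st]; rewrite kk ?gg ?s0//; apply/andP; split; lra.
split.
  by apply: eq_integrable => // s; rewrite inE/= in_itv/= => /E ->.
by apply: eq_Rintegral => s; rewrite inE/= in_itv/= => /E ->.
Qed.

Lemma volterra_conv_setT (k g : R -> R) (t : R) :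
  (forall x, x < 0 -> k x = 0) -> (forall x, x < 0 -> g x = 0) ->
  (\int[mu]_s (k (t - s) * g s)%:E = \int[mu]_(s in `[0%R, t]) (k (t - s) * g s)%:E)%E.
Proof.
move=> k0 g0; apply: integral_support => s /=; rewrite in_itv/= => /negP.
rewrite negb_and -!ltNge => /orP[s0|ts]; first by rewrite g0// mulr0.
by rewrite k0 ?mul0r// subr_lt0.
Qed.

(** Applied to a Sonine pair, whose convolution is 1, this shows that each member has positive mass
    arbitrarily close to 0. *)
Lemma volterra_conv_neq0_gt0 (k g : R -> R) (t : R) :
  measurable_fun setT k -> measurable_fun setT g ->
  volterra_conv k g t != 0 -> (0 < \int[mu]_(s in `[0%R, t]) `|g s|%:E)%E.
Proof.
move=> mk mg; apply: contra_neqT; rewrite -leNgt => int0.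
have mI : measurable (`[0, t] : set R) by exact: measurable_itv.
have : ae_eq mu (`[0, t]%classic : set R) (EFin \o g) (cst 0%E).
  apply/ae_eq_integral_abs => //; first by apply/measurable_EFinP; exact: measurable_funTS.
  by apply/eqP; rewrite eq_le; apply/andP; split; [exact: int0|exact: integral_ge0].
move=> g0; rewrite /volterra_conv /Rintegral (_ : integral _ _ _ = 0%E)//.
rewrite (@ae_eq_integral _ _ _ mu `[0, t]%classic (cst 0%E))//.
- exact: integral0.
- apply: measurable_funTS; apply/measurable_EFinP; apply: measurable_funM => //.
  by apply: measurableT_comp => //; exact: measurable_funB.
by apply: lebesgue_aeS g0 => s /[apply] -[->]; rewrite mulr0.
Qed.

(** Countably many intervals [0, T (1 - 1/(n + 2))] cover [0, T[; the shift by 2 keeps their right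
    ends strictly between 0 and T. *)
Lemma ae_itv_exhaust (T : R) (P : R -> Prop) : 0 < T ->
  (forall S, 0 < S < T -> {ae mu, forall t, t \in `[0, S] -> P t}) ->
  {ae mu, forall t, t \in `[0, T] -> P t}.
Proof.
move=> T0 h; apply: ae_interior_itv.
have hn (n : nat) : {ae mu, forall t, t \in `[0, T * (1 - n.+2%:R^-1)] -> P t}.
  apply: h.
  have n2 : 0 < n.+2%:R^-1 :> R by rewrite invr_gt0.
  have n1 : n.+2%:R^-1 < 1 :> R by rewrite invf_lt1// ltr1n.
  by rewrite mulr_gt0 ?subr_gt0//= gtr_pMr// ltrBlDr ltrDl.
apply: lebesgue_aeS (ae_foralln hn) => t Pt; rewrite in_itv/= => /andP[t0 tT].
have r0 : 0 < 1 - t / T by rewrite subr_gt0 ltr_pdivrMr// mul1r.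
have [n nP] : exists n : nat, n.+2%:R^-1 <= 1 - t / T.
  exists (Num.bound (1 - t / T)^-1); rewrite invf_ple ?posrE//.
  rewrite ltW// (lt_le_trans (archi_boundP _))// ?invr_ge0 ?(ltW r0)//.
  by rewrite ler_nat (leq_trans (leqnSn _)).
apply: (Pt n); rewrite in_itv/= (ltW t0)/= (mulrC T) -ler_pdivrMr//.
by rewrite lerBrDr -lerBrDl.
Qed.

End sonine_data.

(** * Integrability of a f and u / b on [0, S] for S < T *)

Section local_integrability_data.
Context {R : realType}.
Notation mu := (@lebesgue_measure R).
Variables (T S : R).
Hypothesis ST : 0 < S < T.

Let d0 : 0 < T - S <= T.
Proof. by case/andP: ST => S0 sT; apply/andP; split; lra. Qed.

Lemma local_integrable_of_kernel (kappa m w : R -> R) :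
  measurable_fun setT kappa -> measurable_fun setT m -> measurable_fun setT w ->
  {ae mu, forall t, t \in `[0, T] -> 0 < `|kappa t|} ->
  (0 < \int[mu]_(s in `[0%R, (T - S)%R]) `|m s|%:E)%E ->
  (\int[mu]_s \int[mu]_t `|(w s * kappa t * m (t - s))%:E| < +oo)%E ->
  mu.-integrable setT (EFin \o w \_ `[0, S]).
Proof.
move=> mk mm mw kpos mpos fin.
have n (f : R -> R) : measurable_fun setT f -> measurable_fun setT (fun x => `|f x|).
  by move=> mf; exact: measurableT_comp.
have := conv_local_integrability d0 (n _ mk) (n _ mm) (n _ mw)
  (fun=> normr_ge0 _) (fun=> normr_ge0 _) (fun=> normr_ge0 _) kpos mpos.
have -> : T - (T - S) = S by ring.
move=> h; rewrite -restrict_EFin; apply/integrable_restrict => //=; rewrite setTI.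
apply/integrableP; split; first by apply/measurable_EFinP; exact: measurable_funTS.
apply: h; apply: le_lt_trans fin; rewrite le_eqVlt; apply/orP; left; apply/eqP.
apply: eq_integral => s _; apply: eq_integral => t _.
by rewrite /= !normrM; congr EFin; ring.
Qed.

(** Only pointwise finiteness in t of |h| * |g| is given; a positive weight in t makes its integral
    finite, and the double-integral criterion then applies. *)
Lemma local_integrable_of_volterra (h g : R -> R) :
  measurable_fun setT h -> measurable_fun setT g ->
  (forall x, x < 0 -> h x = 0) -> (forall x, x < 0 -> g x = 0) ->
  (0 < \int[mu]_(s in `[0%R, (T - S)%R]) `|h s|%:E)%E ->
  (forall t, 0 <= t <= T -> volterra_conv_defined h g t) ->
  mu.-integrable setT (EFin \o g \_ `[0, S]).
Proof.
move=> mh mg h0 g0 hpos def.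
pose ah x : \bar R := `|(h x)%:E|%E; pose ag x : \bar R := `|(g x)%:E|%E.
have mah : measurable_fun setT ah by apply: measurableT_comp => //; exact/measurable_EFinP.
have mag : measurable_fun setT ag by apply: measurableT_comp => //; exact/measurable_EFinP.
have ah0 x : (0 <= ah x)%E by exact: abse_ge0.
have ag0 x : (0 <= ag x)%E by exact: abse_ge0.
pose Phi := econv ah ag.
have mPhi : measurable_fun setT Phi by exact: measurable_econv.
have Phi0 t : (0 <= Phi t)%E by exact: econv_ge0.
have fPhi t : 0 <= fine (Phi t) by exact: fine_ge0.
have PhiE t : Phi t = (\int[mu]_s (`|h (t - s)| * `|g s|)%:E)%E.
  by apply: eq_integral => s _; rewrite /ah /ag -abseM /= normrM.
have Phifin t : 0 <= t <= T -> Phi t \is a fin_num.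
  move=> /def/integrableP[_ jt]; rewrite ge0_fin_numE// PhiE.
  rewrite (@volterra_conv_setT _ (fun x => `|h x|) (fun x => `|g x|)); last 2 first.
  - by move=> x /h0 ->; rewrite normr0.
  - by move=> x /g0 ->; rewrite normr0.
  apply: le_lt_trans jt; rewrite le_eqVlt; apply/orP; left; apply/eqP.
  by apply: eq_integral => s _; rewrite /= normrM.
(* With this weight the inner integral is Phi / (1 + Phi) <= 1 on [0, T], so the double integral is
   at most T. *)
pose kappa (t : R) : R := \1_(`[0, T]) t * (1 + fine (Phi t))^-1.
have mkappa : measurable_fun setT kappa.
  apply: measurable_funM; first exact: measurable_indic.
  apply: measurable_fun_inv; apply: measurable_funD => //.
  by apply: (measurableT_comp _ mPhi) => //; exact: fine_measurable.
have kappa0 t : 0 <= kappa t by rewrite mulr_ge0// invr_ge0 addr_ge0.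
apply: (@local_integrable_of_kernel kappa h) => //.
  apply: aeW => t tT; rewrite normr_gt0 /kappa indicE mem_setE tT mul1r invr_eq0.
  by rewrite gt_eqF// ltr_pwDl.
have mF : measurable_fun setT (fun z : R * R => `|(g z.1 * kappa z.2 * h (z.2 - z.1))%:E|)%E.
  apply: measurableT_comp => //; apply/measurable_EFinP; apply: measurable_funM.
    by apply: measurable_funM; exact: measurableT_comp.
  by apply: measurableT_comp => //; exact: measurable_funB.
have -> : (\int[mu]_s \int[mu]_t `|(g s * kappa t * h (t - s))%:E| =
    \int[mu]_t \int[mu]_s `|(g s * kappa t * h (t - s))%:E|)%E.
  exact: (@fubini_tonelli _ _ _ _ R mu mu _ mF (fun=> abse_ge0 _)).
apply: (@le_lt_trans _ _ (\int[mu]_t (\1_(`[0%R, T]) t)%:E)%E); last first.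
  have mT : measurable (`[0, T]%classic : set (measurableTypeR R)) by exact: measurable_itv.
  have := @integral_indic _ _ R mu setT measurableT _ mT; rewrite setIT => ->.
  have : (mu `[0%R, T]%classic < +oo)%E.
    by rewrite lebesgue_measure_itv/=; case: ifP => _; rewrite ?sube0 ltry.
  by [].
apply: ge0_le_integral => //.
- by move=> t _; exact: integral_ge0.
- exact: (@measurable_fun_fubini_tonelli_G _ _ _ _ R mu _ mF (fun=> abse_ge0 _)).
- exact/measurable_EFinP.
move=> t _.
have -> : (\int[mu]_s `|(g s * kappa t * h (t - s))%:E| = (kappa t)%:E * Phi t)%E.
  rewrite PhiE -ge0_integralZl//; last 2 first.
  - apply/measurable_EFinP; apply: measurable_funM; last exact: measurableT_comp.
    have mhB : measurable_fun setT (fun s : R => h (t - s)).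
      by apply: (measurableT_comp mh); exact: measurable_funB.
    exact: measurableT_comp.
  - by rewrite lee_fin.
  apply: eq_integral => s _; rewrite /= (normrM (g s * kappa t)) (normrM (g s)) (ger0_norm (kappa0 t)) -EFinM.
  by congr EFin; ring.
rewrite /kappa indicE mem_setE in_itv/=.
have [tT|_] := boolP (0 <= t <= T); last by rewrite !mul0r mul0e.
rewrite mul1r -(fineK (Phifin t tT)) -EFinM lee_fin.
by rewrite /= mulrC ler_pdivrMr ?mul1r ?lerDr// ltr_pwDl.
Qed.

End local_integrability_data.

(** * Chain of equivalences on [0, S] and passage to [0, T] *)

Theorem lemma7 (R : realType) (T : R) (hT : 0 < T)
  (a b c h u : R -> R) (p q r : \bar R)
  (* (C1) *)
  (hp : (2%:E <= p)%E) (hq : (1 <= q)%E) (hr : (1 <= r)%E)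
  (hpqr : (p^-1 + q^-1 + r^-1 <= (3 / 2)%:E)%E)
  (ha : Lp_on T p a) (hb : Lp_on T q b) (hc : Lp_on T r c)
  (* (C2) *)
  (ha_pos : {ae @lebesgue_measure R, forall t, t \in `[0, T] -> 0 < a t})
  (hb_pos : {ae @lebesgue_measure R, forall t, t \in `[0, T] -> 0 < b t})
  (* (C3) *)
  (hch : sonine_pair T c h)
  (* the right-hand side of the equation is defined on [0, T] *)
  (hu : Lp_on T 1 u)
  (* the right-hand side of the formula is well defined, with D in L_1 *)
  (hD : Dfrac_defined T h (fun s => u s * (b s)^-1))
  (hD1 : Lp_on T 1 (Dfrac h (fun s => u s * (b s)^-1))) :
  forall f : R -> R, Kop_admissible T a b c f ->
    ((forall t : R, 0 <= t <= T ->
        Kop a b c f t = \int[@lebesgue_measure R]_(z in `[0, t]) u z) <->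
     {ae @lebesgue_measure R, forall t, t \in `[0, T] ->
        f t = (a t)^-1 * Dfrac h (fun s => u s * (b s)^-1) t}).
Proof.
move=> f adm.
set g := fun s => u s * (b s)^-1 in hD hD1 *.
set mu := @lebesgue_measure R.
have r1 := hr; have p1 : (1 <= p)%E by apply: le_trans hp; rewrite lee_fin ler1n.
have [mphi iK] := Kop_kernel_integrable hp hq hr hpqr ha hb hc adm.
pose c0 := c \_ `[0, T]; pose h0 := h \_ `[0, T]; pose phi0 := (a \* f) \_ `[0, T].
pose g0 := g \_ `[0, T]; pose b0 := b \_ `[0, T].
have rE (k : R -> R) S t : (k \_ `[0, S]) t = if 0 <= t <= S then k t else 0.
  by rewrite patchE mem_setE in_itv.
have neg0 (k : R -> R) S x : x < 0 -> (k \_ `[0, S]) x = 0.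
  by move=> x0; rewrite rE leNgt x0.
have mc : measurable_fun setT c0 := Lp_on_measurable hc.
have mb : measurable_fun setT b0 := Lp_on_measurable hb.
have [hL1 hsonine] := hch.
have mh : measurable_fun setT h0 := Lp_on_measurable hL1.
have ic : mu.-integrable setT (EFin \o c0) := Lp_on_integrable hr hc.
have ih : mu.-integrable setT (EFin \o h0) := Lp_on_integrable (lexx 1%E) hL1.
have iu := Lp_on_integrable (lexx 1%E) hu.
have mu0 := Lp_on_measurable hu.
have mg : measurable_fun setT g0.
  rewrite (_ : g0 = fun s => u \_ `[0, T] s * (b0 s)^-1).
    by apply: measurable_funM => //; exact: measurable_fun_inv.
  by apply/funext => s; rewrite /g0 /b0 !rE; case: ifP => //; rewrite mul0r.
have conv0 (k g' : R -> R) t : t <= T ->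
    (volterra_conv_defined k g' t -> volterra_conv_defined (k \_ `[0, T]) (g' \_ `[0, T]) t) /\
    volterra_conv k g' t = volterra_conv (k \_ `[0, T]) (g' \_ `[0, T]) t.
  move=> tT; apply: volterra_conv_eq => s /andP[s0 st];
    by rewrite rE s0 (le_trans st tT).
have P0 t : 0 < t <= T -> volterra_conv_defined c0 h0 t /\ volterra_conv c0 h0 t = 1.
  move=> /[dup] /andP[_ tT] /hsonine[d <-].
  by have [d' ->] := conv0 c h t tT; split => //; exact: d'.
have g_def t : 0 <= t <= T -> volterra_conv_defined h0 g0 t.
  by case: hD => hdef _ /[dup] /andP[_ tT] /hdef; exact: (conv0 h g t tT).1.
pose H := volterra_conv h g.
have HE t : 0 <= t <= T -> H t = volterra_conv h0 g0 t.
  by move=> /andP[_ tT]; exact: (conv0 h g t tT).2.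
have hAC : abs_cont_on 0 T H by case: hD.
have H_cont := abs_cont_within_continuous hT hAC.
have b0pos : {ae mu, forall t, t \in `[0, T] -> 0 < `|b0 t|}.
  apply: lebesgue_aeS hb_pos => t bt tT; rewrite normr_gt0 gt_eqF// /b0 patchE mem_setE tT.
  exact: bt.
pose phiS S := phi0 \_ `[0, S]; pose gS S := g0 \_ `[0, S].
(* The factor c has positive mass on [0, T - S] because h * c = 1 at T - S. *)
have i_phiS S : 0 < S < T -> mu.-integrable setT (EFin \o phiS S).
  move=> ST; apply: (local_integrable_of_kernel ST mb mc mphi b0pos).
    apply: (volterra_conv_neq0_gt0 (k := h0)) => //.
    have dT : 0 < T - S <= T by case/andP: ST => S0 sT; apply/andP; split; lra.
    have [d e] := P0 _ dT; have [_ e'] := volterra_convC mc mh d.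
    by rewrite e' e oner_neq0.
  have /integrableP[mK _] := iK.
  exact: ((integrable12ltyP mu mu mK).1 iK).
have i_gS S : 0 < S < T -> mu.-integrable setT (EFin \o gS S).
  move=> ST; apply: (local_integrable_of_volterra ST mh mg) => //; [exact: neg0|exact: neg0|].
  apply: (volterra_conv_neq0_gt0 (k := c0)) => //.
  have dT : 0 < T - S <= T by case/andP: ST => S0 sT; apply/andP; split; lra.
  by have [_ ->] := P0 _ dT; rewrite oner_neq0.
pose X1 S := {ae mu, forall v, v \in `[0, S] ->
  (\int[mu]_s (c0 (v - s) * phiS S s)%:E = (gS S v)%:E)%E}.
pose X2 S := {ae mu, forall t, t \in `[0, S] ->
  (\int[mu]_s (h0 (t - s) * gS S s)%:E = \int[mu]_(s in `[0%R, t]) (phiS S s)%:E)%E}.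
have X12 S : 0 < S < T -> X1 S <-> X2 S.
  move=> ST; apply: (sonine_equivalence (proj1 (andP ST)) ic ih (i_gS S ST) (i_phiS S ST)).
  - by move=> x; exact: neg0.
  - by move=> x; exact: neg0.
  - by move=> x; exact: neg0.
  - by move=> x; exact: neg0.
  - by move=> t /andP[t0 tS]; apply: P0; rewrite t0 (le_trans tS)// ltW//; case/andP: ST.
(* Both sides are continuous on [0, S], so the a.e. identity holds at every point. *)
have X2E S : 0 < S < T -> X2 S <-> (forall t, 0 <= t <= S -> H t = \int[mu]_(s in `[0, t]) phiS S s).
  move=> ST; have /andP[S0 sT] := ST.
  have iS : mu.-integrable `[0, S] (EFin \o phiS S) by exact: integrableS (i_phiS S ST).
  have HS t : 0 <= t <= S -> (\int[mu]_s (h0 (t - s) * gS S s)%:E = (H t)%:E)%E.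
    move=> /andP[t0 tS]; have tT : 0 <= t <= T by rewrite t0 (le_trans tS)// ltW.
    rewrite volterra_conv_setT; [|exact: neg0|exact: neg0].
    rewrite HE// /volterra_conv /Rintegral fineK; last by exact: integrable_fin_num (g_def t tT).
    apply: eq_integral => s; rewrite inE/= in_itv/= => /andP[s0 st].
    by rewrite /gS rE s0 (le_trans st tS).
  have phiSfin t : 0 <= t <= S -> (\int[mu]_(s in `[0%R, t]) (phiS S s)%:E =
      (\int[mu]_(s in `[0%R, t]) phiS S s)%:E)%E.
    move=> _; rewrite /Rintegral fineK//; apply: integrable_fin_num => //.
    exact: integrableS (i_phiS S ST).
  split=> [x2|HI].
    apply: (ae_eq_within_continuous S0) => //.
    - apply: continuous_subspaceW H_cont; apply: subset_itvl.
      by rewrite bnd_simp ltW.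
    - exact: within_continuous_integral (ltW S0) iS.
    - apply: lebesgue_aeS x2 => t + tS => /(_ tS).
      rewrite in_itv/= in tS; by rewrite HS// phiSfin// => -[].
  by apply: aeW => t; rewrite in_itv/= => tS; rewrite HS// HI// phiSfin.
have Zc := volterra_density_conv iK hb_pos.
pose Z := volterra_density T a b c f.
have iZ : mu.-integrable setT (EFin \o Z) := integrable_volterra_density iK.
have ZE t : 0 <= t <= T -> Kop a b c f t = \int[mu]_(v in `[0, t]) Z v.
  by move=> tT; apply: Kop_integral.
have mI S : measurable (`[0, S] : set (measurableTypeR R)) by exact: measurable_itv.
have iuT : mu.-integrable `[0, T] (EFin \o u).
  apply: eq_integrable (integrableS measurableT (mI T) (@subsetT _ _) iu) => // s.
  by rewrite inE/= in_itv/= => sT; rewrite rE sT.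
have iZT : mu.-integrable `[0, T] (EFin \o Z) by exact: integrableS iZ.
have sub t : 0 <= t <= T -> `[0, t] `<=` `[0, T].
  by move=> /andP[_ tT]; apply: subset_itvl; rewrite bnd_simp.
have KZ : (forall t, 0 <= t <= T -> Kop a b c f t = \int[mu]_(z in `[0, t]) u z) <->
    {ae mu, forall v, v \in `[0, T] -> Z v = u v}.
  split=> [KI|Zu t tT].
    have iZu : mu.-integrable `[0, T] (EFin \o (Z \- u)).
      by apply: eq_integrable (integrableB (mI T) iZT iuT).
    have := integral_eq0_ae_eq0 hT iZu.
    have zero : {ae mu, forall t, t \in `[0, T] -> \int[mu]_(s in `[0, t]) (Z \- u) s = 0}.
      apply: aeW => t; rewrite in_itv/= => tT.
      rewrite RintegralB//; last 2 first.
      - exact: (integrableS (mI T) (mI t) (sub t tT) iZT).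
      - exact: (integrableS (mI T) (mI t) (sub t tT) iuT).
      by rewrite -ZE// KI// subrr.
    move=> /(_ zero); apply: lebesgue_aeS => v /[apply] /= /eqP.
    by rewrite subr_eq0 => /eqP.
  rewrite ZE// /Rintegral; congr fine; apply: ae_eq_integral => //.
  - by apply: measurable_int; exact: (integrableS (mI T) (mI t) (sub t tT) iZT).
  - by apply: measurable_int; exact: (integrableS (mI T) (mI t) (sub t tT) iuT).
  apply: lebesgue_aeS Zu => v Zv vt; rewrite /= Zv//; exact: (sub t tT).
have ZX1 : {ae mu, forall v, v \in `[0, T] -> Z v = u v} <-> forall S, 0 < S < T -> X1 S.
  (* Causality: for v <= S the convolution at v only sees a f on [0, S], so truncating it at S
     changes nothing. *)
  have key S v : 0 < S < T -> v \in `[0, S] ->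
      (\int[mu]_s (c0 (v - s) * phiS S s)%:E = \int[mu]_s (c0 (v - s) * phi0 s)%:E)%E.
    move=> /andP[S0 sT]; rewrite in_itv/= => /andP[v0 vS]; apply: eq_integral => s _.
    congr EFin; rewrite /phiS rE; case: ifPn => //; rewrite negb_and -!ltNge.
    move=> /orP[s0|Ss]; first by rewrite /phi0 neg0.
    by rewrite /c0 neg0 ?mul0r// subr_lt0 (le_lt_trans vS).
  have vT S v : 0 < S < T -> v \in `[0, S] -> v \in `[0, T].
    by move=> /andP[S0 sT]; rewrite !in_itv/= => /andP[-> vS]; rewrite (le_trans vS)// ltW.
  split=> [Zu S ST|x1].
    apply: lebesgue_aeS2 hb_pos (lebesgue_aeS2 (fun v => @conj _ _) Zu Zc) => v bv [Zv cv] vS.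
    have vT' := vT _ _ ST vS; have [e1 i1] := cv vT'; have bv0 := bv vT'.
    rewrite key// -[LHS]fineK; last exact: integrable_fin_num.
    congr EFin; apply: (@mulfI _ (b v)); first by rewrite gt_eqF.
    rewrite -e1 -/Z Zv// /gS /g0 patchE mem_setE vS patchE mem_setE vT' /g.
    by rewrite mulrCA mulfV ?mulr1// gt_eqF.
  apply: ae_itv_exhaust hT _ => S ST.
  apply: lebesgue_aeS2 hb_pos (lebesgue_aeS2 (fun v => @conj _ _) (x1 S ST) Zc) => v bv [xv cv] vS.
  have vT' := vT _ _ ST vS; have [e1 i1] := cv vT'; have bv0 := bv vT'.
  rewrite /Z e1 -(key S)// xv//= /gS /g0 patchE mem_setE vS patchE mem_setE vT' /g.
  by rewrite mulrCA mulfV ?mulr1// gt_eqF.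
have aD : (forall S, 0 < S < T -> X2 S) <->
    {ae mu, forall t, t \in `[0, T] -> f t = (a t)^-1 * Dfrac h g t}.
  split=> [x2|fD S ST].
    apply: ae_itv_exhaust hT _ => S ST.
    have HI := (X2E S ST).1 (x2 S ST).
    have iS : mu.-integrable `[0, S] (EFin \o phiS S) by exact: integrableS (i_phiS S ST).
    have dH : {ae mu, forall t, t \in `[0, S] -> derive1 H t = phiS S t}.
      apply: (@ae_derive_integral _ S 0) => // t tS; rewrite add0r; exact: HI.
    apply: lebesgue_aeS2 ha_pos dH => t at0 dHt tS.
    have /andP[t0 tS'] : 0 <= t <= S by rewrite in_itv in tS.
    have tT : t \in `[0, T] by rewrite in_itv/= t0 (le_trans tS')// ltW//; case/andP: ST.
    rewrite /Dfrac -/H dHt// /phiS /phi0 patchE mem_setE tS patchE mem_setE tT/=.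
    by rewrite mulKf// gt_eqF// at0.
  apply/X2E => // t tS; have /andP[S0 sT] := ST; have /andP[t0 tS'] := tS.
  have tT : 0 <= t <= T by rewrite t0 (le_trans tS')// ltW.
  (* Recovering H from its derivative: the density w equals H' a.e., and the formula for f says that
     H' = a f. *)
  have [w iw wE] := abs_cont_density hT hAC.
  have iwT : mu.-integrable `[0, T] (EFin \o w) by exact: integrableS iw.
  have Dw := ae_derive_integral iwT wE.
  (* The convolution at 0 is an integral over a single point, so the primitive has no constant
     term. *)
  have H0 : H 0 = 0 by rewrite /H /volterra_conv set_itv1 Rintegral_set1.
  rewrite wE// H0 add0r /Rintegral; congr fine; apply: ae_eq_integral => //.
  - by apply: measurable_funTS; exact: measurable_int iw.
  - by apply: measurable_funTS; exact: measurable_int (i_phiS S ST).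
  apply: lebesgue_aeS2 ha_pos (lebesgue_aeS2 (fun v => @conj _ _) fD Dw) => s as0 [fs Ds].
  rewrite /= in_itv/= => /andP[s0 st].
  have sI : s \in `[0, T] by rewrite in_itv/= s0 (le_trans st)//; case/andP: tT.
  have sS : s \in `[0, S] by rewrite in_itv/= s0 (le_trans st).
  rewrite -Ds// /phiS /phi0 patchE mem_setE sS patchE mem_setE sI/=.
  by congr EFin; rewrite fs// /Dfrac mulVKf// gt_eqF// as0.
rewrite KZ ZX1 -aD; split=> hX S ST; exact/X12/hX.
Qed.
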